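(* Let $g\in A^{k\times\ell}$ be a voting form such that $p\geq 3$ and $\beta\geq 2\alpha$ hold for the corresponding parameters. Then one can recognize in polynomial time (in the size of $g$, i.e. in $k$, $\ell$ and $p$) whether $g$ is a DAV form. If it is, one can also obtain in polynomial time a labeling of the rows and columns of $g$ by the elements of $X$ and $Y$, respectively, i.e. bijective labelings $X=\{x^1,\dots,x^k\}$, $Y=\{y^1,\dots,y^\ell\}$ with $g(i,j)\in AM(x^i+y^j)$ for all $i,j$. Moreover, in that case the labeling of the rows is unique (the same in every such pair of labelings).
   Context: There are two voters. A voting form is a matrix $g\in A^{k\times\ell}$, where $A$, the set of candidates, is the set of elements appearing in the matrix, and $p=|A|$. It is assumed that there are positive integers $\alpha,\beta$ (the numbers of voting cards of the first and second voter) with $k=\binom{\alpha+p-1}{p-1}$ and $\ell=\binom{\beta+p-1}{p-1}$; $p,\alpha,\beta$ are the parameters corresponding to $g$. The sets of voting strategies are $X=\{x\in\mathbb{Z}_{\ge 0}^A : \sum_{a\in A}x_a=\alpha\}$ and $Y=\{y\in\mathbb{Z}_{\ge 0}^A : \sum_{a\in A}y_a=\beta\}$, so $|X|=k$, $|Y|=\ell$. For $z\in\mathbb{Z}^A$ let $AM(z)=\{a\in A : z_a=\max_{c\in A}z_c\}$. The matrix $g$ is a distributed approval voting form (DAV form) if the strategies can be labeled bijectively as $X=\{x^1,\dots,x^k\}$, $Y=\{y^1,\dots,y^\ell\}$ such that $g(i,j)\in AM(x^i+y^j)$ for all $i=1,\dots,k$, $j=1,\dots,\ell$. *)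

(* Defs.v *)
From mathcomp Require Import all_boot all_order all_algebra.

Set Implicit Arguments.
Unset Strict Implicit.
Unset Printing Implicit Defensive.

(* The candidates are exactly the entries of the matrix. The parameters [alpha]
   and [beta] are determined by it as soon as there are two candidates. *)
Record voting_form := VotingForm {
  cand : finType;
  nrows : nat;
  ncols : nat;
  vmatrix : 'M[cand]_(nrows, ncols);
  alpha : nat;
  beta : nat;
  vmatrix_onto : forall a : cand, exists i j, vmatrix i j = a;
  alpha_gt0 : 0 < alpha;
  beta_gt0 : 0 < beta;
  nrowsE : nrows = 'C(alpha + #|cand| - 1, #|cand| - 1);
  ncolsE : ncols = 'C(beta + #|cand| - 1, #|cand| - 1)
}.

Definition strategy (A : finType) (n : nat) :=
  {x : {ffun A -> nat} | \sum_(a : A) x a == n}.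

Definition votes (A : finType) (n : nat) (x : strategy A n) (a : A) : nat :=
  val x a.

(* The maximum runs over all of [A]; its base value [z a] is itself one of the
   values over which it is taken. *)
Definition AM (A : finType) (z : A -> int) : {set A} :=
  [set a | z a == \big[Num.max/z a]_(c : A) z c].

Definition labeling (g : voting_form)
    (x : 'I_(nrows g) -> strategy (cand g) (alpha g))
    (y : 'I_(ncols g) -> strategy (cand g) (beta g)) : Prop :=
  [/\ bijective x, bijective y &
      forall i j,
        vmatrix g i j \in AM (fun a => (votes (x i) a)%:Z + (votes (y j) a)%:Z)%R].

Arguments labeling : clear implicits.

Definition DAV_form (g : voting_form) : Prop := exists x y, labeling g x y.

(* Structured programs for a random access machine whose memory consists of
   arrays of natural numbers; [Cell x e] is the cell of array [x] whose index
   is the value of [e], and [Sub] is truncated. As the only arithmetic is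
   addition and truncated subtraction, each executed operation can add at most
   one bit to the largest number in memory, so that the uniform cost below is
   polynomially related to Turing machine time. A program mentions finitely
   many arrays and constants, independently of the input. *)

Definition memory := nat -> nat -> nat.

Inductive expr :=
  | Const of nat
  | Cell of nat & expr
  | Add of expr & expr
  | Sub of expr & expr.

Inductive prog :=
  | Skip
  | Assign of nat & expr & expr
  | Seq of prog & prog
  | If of expr & prog & prog
  | While of expr & prog.

Fixpoint eval (m : memory) (e : expr) : nat :=
  match e with
  | Const n => n
  | Cell x e1 => m x (eval m e1)
  | Add e1 e2 => eval m e1 + eval m e2
  | Sub e1 e2 => eval m e1 - eval m e2
  end.

Fixpoint cost (e : expr) : nat :=
  match e with
  | Const _ => 1
  | Cell _ e1 => (cost e1).+1
  | Add e1 e2 | Sub e1 e2 => (cost e1 + cost e2).+1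
  end.

Definition update (m : memory) (x i v : nat) : memory :=
  fun x' i' => if (x' == x) && (i' == i) then v else m x' i'.

(* [exec c m t m']: started in memory [m], the program [c] halts after [t]
   elementary operations in memory [m']. Nonzero conditions are true. *)
Inductive exec : prog -> memory -> nat -> memory -> Prop :=
  | ExecSkip m : exec Skip m 1 m
  | ExecAssign m x i e :
      exec (Assign x i e) m (cost i + cost e).+1
           (update m x (eval m i) (eval m e))
  | ExecSeq c1 c2 m t1 m1 t2 m2 :
      exec c1 m t1 m1 -> exec c2 m1 t2 m2 ->
      exec (Seq c1 c2) m (t1 + t2).+1 m2
  | ExecIfTrue e c1 c2 m t m' :
      eval m e != 0 -> exec c1 m t m' ->
      exec (If e c1 c2) m (cost e + t).+1 m'
  | ExecIfFalse e c1 c2 m t m' :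
      eval m e = 0 -> exec c2 m t m' ->
      exec (If e c1 c2) m (cost e + t).+1 m'
  | ExecWhileFalse e c m :
      eval m e = 0 -> exec (While e c) m (cost e).+1 m
  | ExecWhileTrue e c m t1 m1 t2 m2 :
      eval m e != 0 -> exec c m t1 m1 -> exec (While e c) m1 t2 m2 ->
      exec (While e c) m (cost e + t1 + t2).+1 m2.

(* Array 0 holds the number of candidates and the dimensions of the matrix,
   array 1 its entries in row-major order, a candidate being represented by its
   rank in the enumeration of [cand g]. The parameters [alpha] and [beta] are
   not part of the input. *)
Definition input (g : voting_form) : memory := fun x i =>
  match x with
  | 0 => nth 0 [:: #|cand g|; nrows g; ncols g] i
  | 1 => nth 0 [seq (enum_rank (vmatrix g r c) : nat)
               | r <- enum 'I_(nrows g), c <- enum 'I_(ncols g)] i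
  | _ => 0
  end.

Definition input_size (g : voting_form) : nat :=
  nrows g + ncols g + #|cand g|.

(* One program, and one polynomial bound, for all the inputs satisfying [P]. *)
Definition polytime_solvable (P : voting_form -> Prop)
    (correct : voting_form -> memory -> Prop) : Prop :=
  exists (c : prog) (C D : nat), forall g : voting_form, P g ->
    exists (t : nat) (m : memory),
      [/\ exec c (input g) t m, t <= C * input_size g ^ D & correct g m].

Definition answers (Q : voting_form -> Prop) (g : voting_form) (m : memory) :=
  m 2 0 = 1 /\ Q g \/ m 2 0 = 0 /\ ~ Q g.

(* Arrays 3 and 4 hold the row and column labels, one after the other, each
   given by its [#|cand g|] coordinates in the order of the candidates. *)
Definition outputs_labeling (g : voting_form) (m : memory) : Prop :=
  exists x y, [/\ labeling g x y,
    forall (i : 'I_(nrows g)) (a : cand g),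
      m 3 (i * #|cand g| + enum_rank a) = votes (x i) a &
    forall (j : 'I_(ncols g)) (a : cand g),
      m 4 (j * #|cand g| + enum_rank a) = votes (y j) a].

(* Main.v *)
Require Import Defs.
From mathcomp Require Import all_boot all_order all_algebra.
From mathcomp Require Import zify.

Set Implicit Arguments.
Unset Strict Implicit.
Unset Printing Implicit Defensive.

(* For a strategy [u] and candidates [a], [c], put [f u = u a - u c]. If some
   column has the entries [a] in row [i'] and [c] in row [i], then the labels
   [u'], [u] of these rows satisfy [f u' >= f u]; conversely, since
   [beta >= 2 * alpha] and there is a third candidate, such a column exists as
   soon as [f u' >= f u + 3], and mostly also when [f u' = f u + 2]. Hence the
   number of rows [i'] related to row [i] in this way determines [f u] up to an
   error of 1. Two strategies of equal total all of whose differences [u a - u c]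
   agree up to 1 are equal, so the label of a row can be found by trying all
   strategies.

   Once the rows are labelled, labelling the columns is a bipartite perfect
   matching problem, solved by an auction: a column that owns no strategy bids
   for a cheapest admissible one, raising its price by 1. If there is a perfect
   matching, no price exceeds the number [l] of columns, and [l ^ 2] sweeps are
   enough.

   The algorithm is written in a language whose only loops run over the three
   dimensions of the input; its programs are translated to [prog] and take
   polynomial time whatever they do. *)

(** * Loop programs and their translation *)

(* [CSum v q t] and [CFor v q c] let the variable [v] range over the numbers
   below the dimension stored in cell [q] of array 0. *)
Inductive cterm :=
  | CConst of nat
  | CVar of nat
  | CArr of nat & cterm
  | CAdd of cterm & cterm
  | CSub of cterm & cterm
  | CSum of nat & nat & cterm.

Inductive term :=
  | TConst of nat
  | TVar of nat
  | TDim of nat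
  | TArr of nat & term
  | TAdd of term & term
  | TSub of term & term
  | TMul of term & nat
  | TSum of nat & nat & term
  | TInd of form
with form :=
  | FEq of term & term
  | FLe of term & term
  | FLt of term & term
  | FNot of form
  | FAnd of form & form
  | FOr of form & form
  | FAll of nat & nat & form
  | FEx of nat & nat & form.

Scheme term_form_ind := Induction for term Sort Prop
  with form_term_ind := Induction for form Sort Prop.
Combined Scheme term_form_mutind from term_form_ind, form_term_ind.

Inductive cmd :=
  | CAssign of nat & term & term
  | CSeq of cmd & cmd
  | CIf of form & cmd
  | CFor of nat & nat & cmd.

(** [eqn] and the simplification hint below make the lookup of a concrete variable compute. *)
Definition bind (e : nat -> nat) (v i : nat) : nat -> nat :=
  fun w => if eqn w v then i else e w.
Arguments bind e v i w /.

Section Semantics.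
Variable d : nat -> nat.

Fixpoint ceval (e : nat -> nat) (m : memory) (t : cterm) : nat :=
  match t with
  | CConst n => n
  | CVar v => e v
  | CArr x t1 => m x (ceval e m t1)
  | CAdd t1 t2 => ceval e m t1 + ceval e m t2
  | CSub t1 t2 => ceval e m t1 - ceval e m t2
  | CSum v q t1 => \sum_(i < d q) ceval (bind e v i) m t1
  end.

Fixpoint teval (e : nat -> nat) (m : memory) (t : term) : nat :=
  match t with
  | TConst n => n
  | TVar v => e v
  | TDim q => d q
  | TArr x t1 => m x (teval e m t1)
  | TAdd t1 t2 => teval e m t1 + teval e m t2
  | TSub t1 t2 => teval e m t1 - teval e m t2
  | TMul t1 q => teval e m t1 * d q
  | TSum v q t1 => \sum_(i < d q) teval (bind e v i) m t1
  | TInd f => feval e m f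
  end
with feval (e : nat -> nat) (m : memory) (f : form) : bool :=
  match f with
  | FEq t1 t2 => teval e m t1 == teval e m t2
  | FLe t1 t2 => teval e m t1 <= teval e m t2
  | FLt t1 t2 => teval e m t1 < teval e m t2
  | FNot f1 => ~~ feval e m f1
  | FAnd f1 f2 => feval e m f1 && feval e m f2
  | FOr f1 f2 => feval e m f1 || feval e m f2
  | FAll v q f1 => [forall i : 'I_(d q), feval (bind e v i) m f1]
  | FEx v q f1 => [exists i : 'I_(d q), feval (bind e v i) m f1]
  end.

Fixpoint crun (c : cmd) (e : nat -> nat) (m : memory) : memory :=
  match c with
  | CAssign x t1 t2 => update m x (teval e m t1) (teval e m t2)
  | CSeq c1 c2 => crun c2 e (crun c1 e m)
  | CIf f c1 => if feval e m f then crun c1 e m else m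
  | CFor v q c1 =>
      foldl (fun m' i => crun c1 (bind e v i) m') m (iota 0 (d q))
  end.

(* Variables are shifted by one, so that 0 can serve as the dummy variable of
   the sum that replaces a multiplication by a dimension. *)
Fixpoint tcore (t : term) : cterm :=
  match t with
  | TConst n => CConst n
  | TVar v => CVar v.+1
  | TDim q => CArr 0 (CConst q)
  | TArr x t1 => CArr x (tcore t1)
  | TAdd t1 t2 => CAdd (tcore t1) (tcore t2)
  | TSub t1 t2 => CSub (tcore t1) (tcore t2)
  | TMul t1 q => CSum 0 q (tcore t1)
  | TSum v q t1 => CSum v.+1 q (tcore t1)
  | TInd f => fcore f
  end
(* Truth values are 0 and 1. Truncated subtraction makes [no] a negation; applied twice it turns any
   positive number into 1. *)
with fcore (f : form) : cterm :=
  let no t := CSub (CConst 1) t in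
  match f with
  | FEq t1 t2 => no (CAdd (CSub (tcore t1) (tcore t2)) (CSub (tcore t2) (tcore t1)))
  | FLe t1 t2 => no (CSub (tcore t1) (tcore t2))
  | FLt t1 t2 => no (no (CSub (tcore t2) (tcore t1)))
  | FNot f1 => no (fcore f1)
  | FAnd f1 f2 => no (CAdd (no (fcore f1)) (no (fcore f2)))
  | FOr f1 f2 => no (no (CAdd (fcore f1) (fcore f2)))
  | FAll v q f1 => no (CSum v.+1 q (no (fcore f1)))
  | FEx v q f1 => no (no (CSum v.+1 q (fcore f1)))
  end.

(** [e' 0] stays unconstrained: a sum that stands for a product rebinds variable 0 without affecting
    its body. *)
Lemma coreP m : (forall q, m 0 q = d q) ->
  (forall t e e', (forall v, e' v.+1 = e v) -> ceval e' m (tcore t) = teval e m t) /\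
  (forall f e e', (forall v, e' v.+1 = e v) -> ceval e' m (fcore f) = feval e m f).
Proof.
move=> md.
have ext v i e e' : (forall v, e' v.+1 = e v) ->
    forall w, bind e' v.+1 i w.+1 = bind e v i w.
  by move=> ee' w /=; rewrite ee'.
apply: term_form_mutind => /=.
- by [].
- by move=> v e e' ->.
- by [].
- by move=> x t IH e e' /IH ->.
- by move=> t1 IH1 t2 IH2 e e' ee'; rewrite (IH1 e) // (IH2 e).
- by move=> t1 IH1 t2 IH2 e e' ee'; rewrite (IH1 e) // (IH2 e).
- move=> t IH q e e' ee'.
  under eq_bigr => i _ do rewrite (IH e) //.
  by rewrite sum_nat_const card_ord mulnC.
- move=> v q t IH e e' ee'; apply: eq_bigr => i _; apply: IH; exact: ext.
- by [].
- by move=> t1 IH1 t2 IH2 e e' ee'; rewrite (IH1 e) // (IH2 e) //; lia.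
- by move=> t1 IH1 t2 IH2 e e' ee'; rewrite (IH1 e) // (IH2 e) //; lia.
- by move=> t1 IH1 t2 IH2 e e' ee'; rewrite (IH1 e) // (IH2 e) //; lia.
- by move=> f IH e e' ee'; rewrite (IH e) //; case: feval.
- by move=> f1 IH1 f2 IH2 e e' ee'; rewrite (IH1 e) // (IH2 e) //; do 2!case: feval.
- by move=> f1 IH1 f2 IH2 e e' ee'; rewrite (IH1 e) // (IH2 e) //; do 2!case: feval.
- move=> v q f IH e e' ee'.
  have E i : ceval (bind e' v.+1 i) m (fcore f) = feval (bind e v i) m f.
    by apply: IH; apply: ext.
  under eq_bigr => i _ do rewrite E.
  case: (boolP [forall i, _]) => [/forallP all_f|/forallPn[i /negPf ni]].
    by rewrite big1 // => i _; rewrite all_f.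
  by rewrite (bigD1 i) //= ni; lia.
- move=> v q f IH e e' ee'.
  have E i : ceval (bind e' v.+1 i) m (fcore f) = feval (bind e v i) m f.
    by apply: IH; apply: ext.
  under eq_bigr => i _ do rewrite E.
  case: (boolP [exists i, _]) => [/existsP[i fi]|/existsPn no_f].
    by rewrite (bigD1 i) //= fi; lia.
  by rewrite big1 // => i _; rewrite (negPf (no_f i)).
Qed.

Definition shift (e : nat -> nat) v := if v is w.+1 then e w else 0.

Lemma tcoreP m e t : (forall q, m 0 q = d q) ->
  ceval (shift e) m (tcore t) = teval e m t.
Proof. by case/coreP => tP _; apply: tP. Qed.

Lemma fcoreP m e f : (forall q, m 0 q = d q) ->
  ceval (shift e) m (fcore f) = feval e m f.
Proof. by case/coreP => _ fP; apply: fP. Qed.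

End Semantics.

(* In compiled programs, array 5 holds the loop variables and array 6 the
   intermediate values. *)
Definition floop (v q : nat) (c : prog) : prog :=
  Seq (Assign 5 (Const v) (Const 0))
    (While (Defs.Sub (Cell 0 (Const q)) (Cell 5 (Const v)))
       (Seq c (Assign 5 (Const v) (Add (Cell 5 (Const v)) (Const 1))))).

(** Array 6 serves as a stack: the value goes to cell [n], and only cells from [n] upwards are
    overwritten. *)
Fixpoint tcomp (n : nat) (t : cterm) : prog :=
  match t with
  | CConst k => Assign 6 (Const n) (Const k)
  | CVar v => Assign 6 (Const n) (Cell 5 (Const v))
  | CArr x t1 => Seq (tcomp n t1) (Assign 6 (Const n) (Cell x (Cell 6 (Const n))))
  | CAdd t1 t2 => Seq (Seq (tcomp n t1) (tcomp n.+1 t2))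
      (Assign 6 (Const n) (Add (Cell 6 (Const n)) (Cell 6 (Const n.+1))))
  | CSub t1 t2 => Seq (Seq (tcomp n t1) (tcomp n.+1 t2))
      (Assign 6 (Const n) (Defs.Sub (Cell 6 (Const n)) (Cell 6 (Const n.+1))))
  | CSum v q t1 => Seq (Assign 6 (Const n) (Const 0))
      (floop v q (Seq (tcomp n.+1 t1)
         (Assign 6 (Const n) (Add (Cell 6 (Const n)) (Cell 6 (Const n.+1))))))
  end.

Fixpoint ccomp (c : cmd) : prog :=
  match c with
  | CAssign x t1 t2 => Seq (Seq (tcomp 0 (tcore t1)) (tcomp 1 (tcore t2)))
      (Assign x (Cell 6 (Const 0)) (Cell 6 (Const 1)))
  | CSeq c1 c2 => Seq (ccomp c1) (ccomp c2)
  | CIf f c1 => Seq (tcomp 0 (fcore f)) (If (Cell 6 (Const 0)) (ccomp c1) Skip)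
  | CFor v q c1 => floop v.+1 q (ccomp c1)
  end.

(** [sc] lists the variables in scope. A summation variable must be new, as an inner loop on the
    same variable would destroy the counter of the outer one. *)
Fixpoint twf (sc : seq nat) (t : cterm) : bool :=
  match t with
  | CConst _ => true
  | CVar v => v \in sc
  | CArr x t1 => (x \notin [:: 5; 6]) && twf sc t1
  | CAdd t1 t2 | CSub t1 t2 => twf sc t1 && twf sc t2
  | CSum v q t1 => (v \notin sc) && twf (v :: sc) t1
  end.

(** Array 0 is write-protected as well, so that the loop bounds stay constant. *)
Fixpoint cwf (sc : seq nat) (c : cmd) : bool :=
  match c with
  | CAssign x t1 t2 => [&& x \notin [:: 0; 5; 6], twf sc (tcore t1) & twf sc (tcore t2)]
  | CSeq c1 c2 => cwf sc c1 && cwf sc c2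
  | CIf f c1 => twf sc (fcore f) && cwf sc c1
  | CFor v q c1 => (v.+1 \notin sc) && cwf (v.+1 :: sc) c1
  end.

Fixpoint ttime (N : nat) (t : cterm) : nat :=
  match t with
  | CConst _ | CVar _ => 10
  | CArr _ t1 => ttime N t1 + 10
  | CAdd t1 t2 | CSub t1 t2 => ttime N t1 + ttime N t2 + 10
  | CSum _ _ t1 => N * (ttime N t1 + 30) + 20
  end.

Fixpoint ctime (N : nat) (c : cmd) : nat :=
  match c with
  | CAssign _ t1 t2 => ttime N (tcore t1) + ttime N (tcore t2) + 10
  | CSeq c1 c2 => ctime N c1 + ctime N c2 + 10
  | CIf f c1 => ttime N (fcore f) + ctime N c1 + 10
  | CFor _ _ c1 => N * (ctime N c1 + 30) + 20
  end.

(** * Execution within a time bound *)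

Definition runs (c : prog) (m : memory) (T : nat) (Q : memory -> Prop) : Prop :=
  exists t m', [/\ exec c m t m', t <= T & Q m'].

Lemma runs_weaken c m T T' (Q Q' : memory -> Prop) :
  runs c m T Q -> T <= T' -> (forall m', Q m' -> Q' m') -> runs c m T' Q'.
Proof.
move=> [t [m' [ex le_t Qm']]] le_T QQ'; exists t, m'; split=> //.
  exact: leq_trans le_T.
exact: QQ'.
Qed.

Lemma runs_le c m T T' (Q : memory -> Prop) :
  runs c m T Q -> T <= T' -> runs c m T' Q.
Proof. by move=> r le_T; apply: runs_weaken r le_T _. Qed.

Lemma runs_assign x i e m (Q : memory -> Prop) :
  Q (update m x (eval m i) (eval m e)) ->
  runs (Assign x i e) m (cost i + cost e).+1 Q.
Proof. by move=> Qm; do 2!eexists; split; [exact: ExecAssign| |]. Qed.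

Lemma runs_seq c1 c2 m T1 T2 (Q : memory -> Prop) :
  runs c1 m T1 (fun m1 => runs c2 m1 T2 Q) -> runs (Seq c1 c2) m (T1 + T2).+1 Q.
Proof.
move=> [t1 [m1 [ex1 le1 [t2 [m2 [ex2 le2 Qm2]]]]]].
do 2!eexists; split; [exact: ExecSeq ex1 ex2| |by []].
by rewrite ltnS leq_add.
Qed.

(** The body is arbitrary code, so the invariant itself must guarantee the loop bound and the
    counter. The 20 covers the test and the increment. *)
Lemma runs_floop v q c m b T (I : nat -> memory -> Prop) :
  (forall i ml, I i ml -> ml 0 q = b /\ ml 5 v = i) ->
  I 0 (update m 5 v 0) ->
  (forall i ml, i < b -> I i ml ->
     runs c ml T (fun ml' => ml' 5 v = i /\ I i.+1 (update ml' 5 v i.+1))) ->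
  runs (floop v q c) m (b * (T + 20) + 15) (I b).
Proof.
move=> Ib I0 Ic.
pose w := While (Defs.Sub (Cell 0 (Const q)) (Cell 5 (Const v)))
  (Seq c (Assign 5 (Const v) (Add (Cell 5 (Const v)) (Const 1)))).
have loop d : forall i ml, i + d = b -> I i ml ->
    runs w ml (d * (T + 20) + 8) (I b).
  elim: d => [|d IHd] i ml eq_b Ii.
    have [eqb eqi] := Ib _ _ Ii.
    exists 6, ml; split=> //; last by rewrite -eq_b addn0.
    by apply: ExecWhileFalse => /=; rewrite eqb eqi -eq_b addn0 subnn.
  have [eqb eqi] := Ib _ _ Ii.
  have lt_ib : i < b by lia.
  have [t1 [ml1 [ex1 le1 [eq1 I1]]]] := Ic _ _ lt_ib Ii.
  have eq_b1 : i.+1 + d = b by lia.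
  have [t2 [ml2 [ex2 le2 I2]]] := IHd _ _ eq_b1 I1.
  do 2!eexists; split; last exact: I2.
    apply: ExecWhileTrue ex2; first by rewrite /= eqb eqi; lia.
    apply: ExecSeq ex1 _.
    have <- : eval ml1 (Add (Cell 5 (Const v)) (Const 1)) = i.+1.
      by rewrite /= eq1 addn1.
    exact: ExecAssign.
  rewrite /= mulSn; lia.
have [t [m' [ex le_t Im']]] := loop b 0 _ (add0n b) I0.
do 2!eexists; split; last exact: Im'.
  by apply: ExecSeq ex; apply: ExecAssign.
rewrite /=; lia.
Qed.

Definition sim (sc : seq nat) (e : nat -> nat) (m ml : memory) : Prop :=
  (forall x i, x \notin [:: 5; 6] -> ml x i = m x i) /\
  {in sc, forall v, ml 5 v = e v}.

Lemma sim_update6 sc e m ml n k : sim sc e m ml -> sim sc e m (update ml 6 n k).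
Proof.
move=> [s1 s2]; split=> [x i x56|v /s2 //]; rewrite /update.
by case: eqP x56 => [->|_ /s1 ->].
Qed.

Lemma sim_bind sc e m ml v i :
  sim sc e m ml -> ml 5 v = i -> sim (v :: sc) (bind e v i) m ml.
Proof.
move=> [s1 s2] eqi; split=> // w; rewrite inE /= -[eqn w v]/(w == v).
by case: eqP => [-> _|_ /s2].
Qed.

Lemma sim_unbind sc e m ml v i k :
  v \notin sc -> sim (v :: sc) (bind e v i) m ml -> sim sc e m (update ml 5 v k).
Proof.
move=> v_sc [s1 s2]; split=> [x j x56|w w_sc]; rewrite /update.
  by case: eqP x56 => [->|_ /s1 ->].
have /s2 : w \in v :: sc by rewrite inE w_sc orbT.
by rewrite /= -[eqn w v]/(w == v); case: (w =P v) w_sc v_sc => [-> -> |].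
Qed.

Lemma sim_update5 sc e m ml v k :
  v \notin sc -> sim sc e m ml -> sim sc e m (update ml 5 v k).
Proof.
move=> v_sc [s1 s2]; split=> [x j x56|w w_sc]; rewrite /update.
  by case: eqP x56 => [->|_ /s1 ->].
by rewrite eqxx /=; case: (w =P v) w_sc v_sc => [-> -> |_ /s2].
Qed.

Lemma sim_assign sc e m ml x i k :
  x \notin [:: 0; 5; 6] -> sim sc e m ml ->
  sim sc e (update m x i k) (update ml x i k).
Proof.
move=> x056 [s1 s2]; split=> [x' j x56|w w_sc]; rewrite /update.
  by rewrite s1.
by case: eqP x056 => [<- //|_ _]; rewrite s2.
Qed.

Lemma update_eq m x i k : update m x i k x i = k.
Proof. by rewrite /update !eqxx. Qed.

Lemma update_neq m x i k x' i' :
  (x' != x) || (i' != i) -> update m x i k x' i' = m x' i'.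
Proof. by rewrite /update; case: eqP; case: eqP. Qed.

Section Compile.
Variables (d : nat -> nat) (N : nat).
Hypothesis dN : forall q, d q <= N.

(** The last clause keeps the left operand of a binary operation safe in cell [n] while the right
    one is computed from cell [n.+1] on. *)
Lemma tcompP t sc e n m ml :
  twf sc t -> (forall q, m 0 q = d q) -> sim sc e m ml ->
  runs (tcomp n t) ml (ttime N t)
    (fun ml' => [/\ sim sc e m ml', ml' 6 n = ceval d e m t &
                    forall r, r < n -> ml' 6 r = ml 6 r]).
Proof.
elim: t sc e n ml => [k|v|x t1 IH1|t1 IH1 t2 IH2|t1 IH1 t2 IH2|v q t1 IH1] sc e n ml /=.
- move=> _ md s; apply: runs_le; first apply: runs_assign.
  + split; [exact: sim_update6 s|exact: update_eq|].
    by move=> r rn; rewrite update_neq //= ltn_eqF.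
  + by [].
- move=> v_sc md s; apply: runs_le; first apply: runs_assign.
  + split; [exact: sim_update6 s|rewrite update_eq /=; exact: (proj2 s)|].
    by move=> r rn; rewrite update_neq //= ltn_eqF.
  + by [].
- move=> /andP[x56 wf1] md s; apply: runs_le; first apply: runs_seq.
  + apply: runs_weaken (IH1 _ _ n _ wf1 md s) (leqnn _) _ => ml' [s' eq1 frm].
    apply: runs_assign; split.
    * exact: sim_update6.
    * by rewrite update_eq /= eq1 (proj1 s').
    * by move=> r rn; rewrite update_neq ?frm //= ltn_eqF.
  + by rewrite /=; lia.
- move=> /andP[wf1 wf2] md s; apply: runs_le; first apply: runs_seq.
  + apply: runs_seq.
    apply: runs_weaken (IH1 _ _ n _ wf1 md s) (leqnn _) _ => ml1 [s1 eq1 frm1].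
    apply: runs_weaken (IH2 _ _ n.+1 _ wf2 md s1) (leqnn _) _ => ml2 [s2 eq2 frm2].
    apply: runs_assign; split.
    * exact: sim_update6.
    * by rewrite update_eq /= eq2 frm2 // eq1.
    * by move=> r rn; rewrite update_neq ?frm2 ?frm1 //= ?ltn_eqF // ltnW.
  + by rewrite /=; lia.
- move=> /andP[wf1 wf2] md s; apply: runs_le; first apply: runs_seq.
  + apply: runs_seq.
    apply: runs_weaken (IH1 _ _ n _ wf1 md s) (leqnn _) _ => ml1 [s1 eq1 frm1].
    apply: runs_weaken (IH2 _ _ n.+1 _ wf2 md s1) (leqnn _) _ => ml2 [s2 eq2 frm2].
    apply: runs_assign; split.
    * exact: sim_update6.
    * by rewrite update_eq /= eq2 frm2 // eq1.
    * by move=> r rn; rewrite update_neq ?frm2 ?frm1 //= ?ltn_eqF // ltnW.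
  + by rewrite /=; lia.
- move=> /andP[v_sc wf1] md s.
  pose I i ml' := [/\ sim sc e m ml', ml' 5 v = i,
    ml' 6 n = \sum_(j < i) ceval d (bind e v j) m t1 &
    forall r, r < n -> ml' 6 r = ml 6 r].
  apply: runs_le; first apply: runs_seq.
  + apply: runs_assign.
    apply: (@runs_weaken _ _ _ _ (I (d q)) _ _ (leqnn _)).
      apply: (@runs_floop _ _ _ _ _ ((ttime N t1 + 8)) I).
      * by move=> i ml' [s' eqi _ _]; split=> //; rewrite (proj1 s').
      * split; rewrite ?update_eq //.
        - by apply: sim_update5 => //; apply: sim_update6.
        - by rewrite update_neq // update_eq big_ord0.
        - by move=> r rn; rewrite !update_neq //= ltn_eqF.
      * move=> i ml1 lt_i [s1 eqi eqs frm1].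
        have s1' := sim_bind s1 eqi.
        apply: runs_le; first apply: runs_seq.
        - apply: runs_weaken (IH1 _ _ n.+1 _ wf1 md s1') (leqnn _) _ => ml2 [s2 eq2 frm2].
          apply: runs_assign; split.
            by rewrite update_neq // (proj2 s2) ?mem_head //= -[eqn v v]/(v == v) eqxx.
          split.
          + by apply: (sim_unbind (i := i)) => //; apply: sim_update6.
          + exact: update_eq.
          + by rewrite update_neq // update_eq /= eq2 frm2 // eqs big_ord_recr.
          + by move=> r rn; rewrite !update_neq ?frm2 ?frm1 //= ?ltn_eqF // ltnW.
        - by rewrite /=; lia.
    by move=> ml' [s' _ eqs frm].
  + rewrite /=; have := dN q; nia.
Qed.

Lemma crun_dims c e m sc q : cwf sc c -> crun d c e m 0 q = m 0 q.
Proof.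
elim: c sc e m => [x t1 t2|c1 IH1 c2 IH2|t c1 IH1|v q' c1 IH1] sc e m /=.
- by case/and3P=> x056 _ _; rewrite update_neq //; case: eqP x056 => [<-|].
- by case/andP=> wf1 wf2; rewrite (IH2 sc) // (IH1 sc).
- by case/andP=> _ wf1; case: (feval _ e m t) => //; apply: IH1 wf1.
- case/andP=> _ wf1; move: (iota 0 _) => s; elim: s m => [|i s IHs] m //=.
  by rewrite IHs (IH1 (v.+1 :: sc)).
Qed.

Lemma ccompP c sc e m ml :
  cwf sc c -> (forall q, m 0 q = d q) -> sim sc (shift e) m ml ->
  runs (ccomp c) ml (ctime N c) (sim sc (shift e) (crun d c e m)).
Proof.
elim: c sc e m ml => [x t1 t2|c1 IH1 c2 IH2|f c1 IH1|v q c1 IH1] sc e m ml /=.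
- case/and3P=> x056 wf1 wf2 md s; apply: runs_le; first apply: runs_seq.
  + apply: runs_seq.
    apply: runs_weaken (tcompP 0 wf1 md s) (leqnn _) _ => ml1 [s1 eq1 frm1].
    apply: runs_weaken (tcompP 1 wf2 md s1) (leqnn _) _ => ml2 [s2 eq2 frm2].
    apply: runs_assign; rewrite /= eq2 frm2 // eq1 !tcoreP //.
    exact: sim_assign.
  + by rewrite /=; lia.
- case/andP=> wf1 wf2 md s; apply: runs_le; first apply: runs_seq.
  + apply: runs_weaken (IH1 _ _ _ _ wf1 md s) (leqnn _) _ => ml1 s1.
    by apply: IH2 s1 => // q; rewrite (crun_dims _ _ _ wf1).
  + by rewrite /=; lia.
- case/andP=> wff wf1 md s.
  apply: runs_le; first apply: (@runs_seq _ _ _ _ (ctime N c1 + 5)).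
  + apply: runs_weaken (tcompP 0 wff md s) (leqnn _) _ => ml1 [s1 eq1 _].
    rewrite fcoreP // in eq1; case: ifPn eq1 => [_|_] eq1.
      have [t' [m' [ex le_t sm']]] := IH1 _ _ _ _ wf1 md s1.
      exists (2 + t').+1, m'; split; last exact: sm'.
        by apply: (@ExecIfTrue (Cell 6 (Const 0))) ex; rewrite /= eq1.
      by move: le_t; lia.
    (* Time 4: 2 for the test, 1 for [Skip], 1 for the conditional. *)
    exists 4, ml1; split=> //; last by rewrite addnC.
    by apply: (@ExecIfFalse (Cell 6 (Const 0)) _ _ _ 1); [rewrite /= eq1|apply: ExecSkip].
  + by rewrite /=; lia.
- case/andP=> v_sc wf1 md s.
  pose M i := foldl (fun m' j => crun d c1 (bind e v j) m') m (iota 0 i).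
  have MS i : M i.+1 = crun d c1 (bind e v i) (M i).
    by rewrite /M -addn1 iotaD foldl_cat.
  have M0 i q' : M i 0 q' = d q'.
    by elim: i => [//|i IHi]; rewrite MS (crun_dims _ _ _ wf1).
  (* The two environments are equal pointwise, and [sim] looks at nothing else. *)
  have sim_shift i m1 ml1 : sim (v.+1 :: sc) (bind (shift e) v.+1 i) m1 ml1 <->
      sim (v.+1 :: sc) (shift (bind e v i)) m1 ml1.
    by split=> -[s1 s2]; split=> // -[|w] /s2.
  pose I i ml' := sim sc (shift e) (M i) ml' /\ ml' 5 v.+1 = i.
  apply: runs_le.
    apply: (@runs_weaken _ _ _ _ (I (d q)) _ _ (leqnn _)).
      apply: (@runs_floop _ _ _ _ (d q) (ctime N c1) I).
      * by move=> i ml' [s' eqi]; rewrite (proj1 s') // M0.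
      * by split; [apply: sim_update5|apply: update_eq].
      * move=> i ml1 lt_i [s1 eqi].
        have /sim_shift s1' := sim_bind s1 eqi.
        apply: runs_weaken (IH1 _ _ _ _ wf1 _ s1') (leqnn _) _ => [q'|ml2 s2].
          exact: M0.
        split; first by rewrite (proj2 s2) ?mem_head //= -[eqn v v]/(v == v) eqxx.
        split; last exact: update_eq.
        by rewrite MS; apply: (sim_unbind (i := i)) => //; apply/sim_shift.
    by move=> ml' [].
  by have := dN q; nia.
Qed.

End Compile.

(** * Polynomial running time *)

Lemma ttime_poly t : exists C D, forall N, 0 < N -> ttime N t <= C * N ^ D.
Proof.
elim: t => [k|v|x t1 [C1 [D1 IH1]]|t1 [C1 [D1 IH1]] t2 [C2 [D2 IH2]]|
   t1 [C1 [D1 IH1]] t2 [C2 [D2 IH2]]|v q t1 [C1 [D1 IH1]]] /=.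
- by exists 10, 0 => N _; rewrite muln1.
- by exists 10, 0 => N _; rewrite muln1.
- exists (C1 + 10), D1 => N N0; have := IH1 N N0.
  by have := expn_gt0 N D1; rewrite N0 /=; nia.
- exists (C1 + C2 + 10), (D1 + D2) => N N0; have := IH1 N N0; have := IH2 N N0.
  have := expn_gt0 N D1; have := expn_gt0 N D2; rewrite N0 /= expnD.
  by move: (N ^ D1) (N ^ D2); nia.
- exists (C1 + C2 + 10), (D1 + D2) => N N0; have := IH1 N N0; have := IH2 N N0.
  have := expn_gt0 N D1; have := expn_gt0 N D2; rewrite N0 /= expnD.
  by move: (N ^ D1) (N ^ D2); nia.
(* A loop multiplies the time by at most [N], which raises the degree by one; 50 absorbs the
   overheads 30 and 20. *)
- exists (C1 + 50), D1.+1 => N N0; have := IH1 N N0.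
  have := expn_gt0 N D1; rewrite N0 /= expnS.
  by move: (N ^ D1); nia.
Qed.

Lemma ctime_poly c : exists C D, forall N, 0 < N -> ctime N c <= C * N ^ D.
Proof.
elim: c => [x t1 t2|c1 [C1 [D1 IH1]] c2 [C2 [D2 IH2]]|t c1 [C2 [D2 IH2]]|
   v q c1 [C1 [D1 IH1]]] /=.
- have [C1 [D1 IH1]] := ttime_poly (tcore t1).
  have [C2 [D2 IH2]] := ttime_poly (tcore t2).
  exists (C1 + C2 + 10), (D1 + D2) => N N0; have := IH1 N N0; have := IH2 N N0.
  have := expn_gt0 N D1; have := expn_gt0 N D2; rewrite N0 /= expnD.
  by move: (N ^ D1) (N ^ D2); nia.
- exists (C1 + C2 + 10), (D1 + D2) => N N0; have := IH1 N N0; have := IH2 N N0.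
  have := expn_gt0 N D1; have := expn_gt0 N D2; rewrite N0 /= expnD.
  by move: (N ^ D1) (N ^ D2); nia.
- have [C1 [D1 IH1]] := ttime_poly (fcore t).
  exists (C1 + C2 + 10), (D1 + D2) => N N0; have := IH1 N N0; have := IH2 N N0.
  have := expn_gt0 N D1; have := expn_gt0 N D2; rewrite N0 /= expnD.
  by move: (N ^ D1) (N ^ D2); nia.
- exists (C1 + 50), D1.+1 => N N0; have := IH1 N N0.
  have := expn_gt0 N D1; rewrite N0 /= expnS.
  by move: (N ^ D1); nia.
Qed.

Definition dims (g : voting_form) (q : nat) : nat :=
  nth 0 [:: #|cand g|; nrows g; ncols g] q.

Definition result (c : cmd) (g : voting_form) : memory :=
  crun (dims g) c (fun=> 0) (input g).

(** The time bound depends on the dimensions only, whatever the memory contains; correctness can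
    then be argued in the loop semantics, away from the scratch arrays. *)
Lemma polytime_cmd (P : voting_form -> Prop) correct c :
  cwf [::] c -> (forall g, P g -> 0 < input_size g) ->
  (forall g m, P g -> (forall x i, x \notin [:: 5; 6] -> m x i = result c g x i) ->
     correct g m) ->
  polytime_solvable P correct.
Proof.
move=> wfc size_gt0 corr; have [C [D poly]] := ctime_poly c.
exists (ccomp c), C, D => g Pg.
have dN q : dims g q <= input_size g.
  by case: q => [|[|[|q]]]; rewrite /input_size /dims /= ?nth_nil; lia.
have s : sim [::] (shift (fun=> 0)) (input g) (input g) by [].
have [//|t [m [ex le_t [s1 _]]]] := ccompP dN wfc _ s.
exists t, m; split=> //; last exact: corr.
exact: leq_trans le_t (poly _ (size_gt0 g Pg)).
Qed.

(** * Proof rules for loop programs *)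

Section Rules.
Variable d : nat -> nat.

Lemma crun_seq c1 c2 e m :
  crun d (CSeq c1 c2) e m = crun d c2 e (crun d c1 e m).
Proof. by []. Qed.

Lemma crun_if f c e m :
  crun d (CIf f c) e m = if feval d e m f then crun d c e m else m.
Proof. by []. Qed.

Lemma crun_assign x i t e m :
  crun d (CAssign x i t) e m = update m x (teval d e m i) (teval d e m t).
Proof. by []. Qed.

Lemma crun_for (I : nat -> memory -> Prop) v q c e m :
  I 0 m ->
  (forall i m', i < d q -> I i m' -> I i.+1 (crun d c (bind e v i) m')) ->
  I (d q) (crun d (CFor v q c) e m).
Proof.
move=> I0 IS /=.
suff : forall i, i <= d q -> I i (foldl (fun m' i => crun d c (bind e v i) m') m (iota 0 i)).
  exact.
elim=> // i IHi lt_i; rewrite -addn1 iotaD foldl_cat addn1 /=.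
by apply: IS => //; apply: IHi; apply: ltnW.
Qed.

Fixpoint assigned (c : cmd) : seq nat :=
  match c with
  | CAssign x _ _ => [:: x]
  | CSeq c1 c2 => assigned c1 ++ assigned c2
  | CIf _ c1 | CFor _ _ c1 => assigned c1
  end.

Lemma crun_frame c e m x i : x \notin assigned c -> crun d c e m x i = m x i.
Proof.
elim: c e m => [y t1 t2|c1 IH1 c2 IH2|f c1 IH1|v q c1 IH1] e m.
- by rewrite inE => neq_xy; rewrite /= update_neq ?neq_xy.
- by rewrite /= mem_cat negb_or => /andP[x1 x2]; rewrite IH2 // IH1.
- by move=> x1; rewrite /=; case: (feval _ _ _ _); rewrite ?IH1.
- move=> x1; apply: (crun_for (I := fun _ m' => m' x i = m x i)) => // j m' _.
  by move=> <-; apply: IH1.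
Qed.

(** Index and value need to be known only in memories that agree with [m] outside row [n] of array
    [x]; all intermediate memories are such. *)
Lemma crun_row v x r t e m n (w : nat -> nat) :
  (forall m' b, b < d 0 ->
     (forall y j, (y != x) || (j < n * d 0) || ((n * d 0 + d 0) <= j) -> m' y j = m y j) ->
     teval d (bind e v b) m' r = n /\ teval d (bind e v b) m' t = w b) ->
  let m' := crun d (CFor v 0 (CAssign x (TAdd (TMul r 0) (TVar v)) t)) e m in
  (forall b, b < d 0 -> m' x (n * d 0 + b) = w b) /\
  (forall y j, (y != x) || (j < n * d 0) || ((n * d 0 + d 0) <= j) -> m' y j = m y j).
Proof.
move=> rt m'; pose I i m1 := 
  (forall b, b < i -> m1 x (n * d 0 + b) = w b) /\
  (forall y j, (y != x) || (j < n * d 0) || ((n * d 0 + d 0) <= j) -> m1 y j = m y j).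
suff : I (d 0) m' by [].
apply: crun_for => [|i m1 lt_i [I1 I2]]; first by split.
have [rE tE] := rt m1 i lt_i I2.
rewrite /= rE tE -[eqn v v]/(v == v) eqxx; split=> [b|y j].
  rewrite ltnS leq_eqVlt => /predU1P[->|lt_b]; first exact: update_eq.
  by rewrite update_neq ?I1 //; lia.
move=> out; rewrite update_neq ?I2 //.
by case: (y == x) out => //=; move/orP; lia.
Qed.

End Rules.


(** * Strategies and the uniqueness of row labels *)

Lemma bijective_finite (T : eqType) n (E : 'I_n -> T) :
  injective E -> (forall z, exists i, E i = z) -> bijective E.
Proof.
move=> E_inj E_onto.
have onto z : exists i, E i == z by have [i <-] := E_onto z; exists i.
exists (fun z => xchoose (onto z)) => [i|z].
  by apply: E_inj; apply/eqP; apply: (xchooseP (onto (E i))).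
by apply/eqP; apply: (xchooseP (onto z)).
Qed.

Lemma sum_votes (A : finType) n (x : strategy A n) : \sum_a votes x a = n.
Proof. by apply/eqP/(valP x). Qed.

Definition to_strategy (A : finType) n (z : {ffun A -> nat})
    (sum_z : \sum_a z a = n) : strategy A n :=
  exist (fun x : {ffun A -> nat} => \sum_a x a == n) z (introT eqP sum_z).

Lemma strategy_inj (A : finType) n (x x' : strategy A n) :
  votes x =1 votes x' -> x = x'.
Proof. by move=> eq_x; apply/val_inj/ffunP. Qed.

(** No coordinate exceeds [n], so strategies correspond to tuples over ['I_n.+1] with sum [n], whose
    number is [card_ord_partitions]. *)
Lemma strategy_bij (A : finType) n : 0 < #|A| ->
  exists E : 'I_('C(n + #|A| - 1, #|A| - 1)) -> strategy A n, bijective E.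
Proof.
move=> A_gt0; set q := #|A| - 1.
have qE : #|A| = q.+1 by rewrite /q; lia.
pose S := [set t : q.+1.-tuple 'I_n.+1 | \sum_(i <- t) i == n].
have card_S : #|S| = 'C(n + #|A| - 1, q).
  by rewrite card_ord_partitions qE; congr 'C(_, _); lia.
pose rk (a : A) : 'I_q.+1 := cast_ord qE (enum_rank a).
pose kr (i : 'I_q.+1) : A := enum_val (cast_ord (esym qE) i).
have rkK : cancel rk kr by move=> a; rewrite /kr cast_ordK enum_rankK.
have krK : cancel kr rk by move=> i; rewrite /rk enum_valK cast_ordKV.
have sumE (F : A -> nat) : \sum_a F a = \sum_i F (kr i).
  by rewrite (reindex kr) //; exists rk => i _.
pose f (t : q.+1.-tuple 'I_n.+1) : {ffun A -> nat} := [ffun a => tnth t (rk a) : nat].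
have fP t : t \in S -> \sum_a f t a == n.
  rewrite inE => /eqP <-; rewrite sumE big_tuple; apply/eqP/eq_bigr => i _.
  by rewrite ffunE krK.
pose E i : strategy A n := exist (fun x : {ffun A -> nat} => \sum_a x a == n)
  _ (fP _ (enum_valP (cast_ord (esym card_S) i))).
exists E; apply: bijective_finite => [i i' /(congr1 val) /= eq_f|z].
  apply: (@cast_ord_inj _ _ (esym card_S)); apply: enum_val_inj.
  apply: eq_from_tnth => r; apply: val_inj.
  by move/ffunP/(_ (kr r)): eq_f; rewrite !ffunE krK.
have z_le a : votes z a < n.+1.
  by have := sum_votes z; rewrite (bigD1 a) //=; lia.
pose t := [tuple Ordinal (z_le (kr i)) | i < q.+1].
have tS : t \in S.
  rewrite inE big_tuple; apply/eqP; rewrite -[RHS](sum_votes z) sumE.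
  by apply: eq_bigr => i _; rewrite tnth_mktuple.
exists (cast_ord card_S (enum_rank_in tS t)); apply: strategy_inj => a.
by rewrite /votes /= cast_ordK enum_rankK_in // ffunE tnth_mktuple /= rkK.
Qed.

Lemma in_AM (A : finType) (x y : A -> nat) a :
  (a \in AM (fun b => (x b)%:Z + (y b)%:Z)%R) =
  [forall c, x c + y c <= x a + y a].
Proof.
rewrite inE; apply/eqP/forallP => [eq_max c|max_a].
  have := Order.TotalTheory.le_bigmax ((x a)%:Z + (y a)%:Z)%R
    (fun b => (x b)%:Z + (y b)%:Z)%R c.
  by rewrite -eq_max; lia.
rewrite Order.TotalTheory.bigmax_eq_id // => c _.
by have := max_a c; lia.
Qed.

(** * Separating ballots and the row test *)

Section Votes.
Variable A : finType.
Implicit Types (u v : A -> nat) (a c : A).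

(** This is [(u a - u c) + d <= v a - v c], written without truncated subtraction. *)
Definition gap d v u a c := u a + v c + d <= v a + u c.

(* Under [separated v u a c] some ballot of the second voter makes [a] the only
   winner against [v] and [c] the only winner against [u]. When the gap is
   exactly 2 this may require giving one vote to a third candidate [b], and then
   [b] could win if [a] and [c] both had no vote in [v] or in [u]. *)
Definition separated v u a c :=
  gap 2 v u a c && (gap 3 v u a c || (0 < v a + v c) && (0 < u a + u c)).

Lemma sum_three v a c e : a != c -> e != a -> e != c ->
  v a + v c + v e <= \sum_b v b.
Proof.
move=> neq_ac neq_ea neq_ec.
rewrite (bigD1 a) //= (bigD1 c) 1?eq_sym //= (bigD1 e) ?neq_ea //=; lia.
Qed.

(** With [ya] votes for [a] and [yc] for [c], the difference [ya - yc] must lie strictly between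
    [v c - v a] and [u c - u a], and have the parity of [n2] if no vote goes elsewhere. A gap of 3
    leaves both parities; a gap of 2 may leave a single value, whose parity is met by giving [eps]
    votes to a third candidate [b]. *)
Lemma separating_votes n1 n2 v u a c :
  3 <= #|A| -> 2 * n1 <= n2 -> \sum_b v b = n1 -> \sum_b u b = n1 ->
  a != c -> separated v u a c ->
  exists2 y : {ffun A -> nat}, \sum_b y b = n2 &
    (forall e, e != a -> v e + y e < v a + y a) /\
    (forall e, e != c -> u e + y e < u c + y c).
Proof.
move=> A3 le_n vn un neq_ac sep.
have [b /andP[neq_ba neq_bc]] : exists b, (b != a) && (b != c).
  apply/existsP; apply: contraLR A3 => /existsPn no_b.
  rewrite -ltnNge ltnS -(cardsT A).
  suff /subset_leq_card : [set: A] \subset [set a; c] by rewrite cards2 neq_ac.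
  apply/subsetP => b _; have := no_b b.
  by rewrite !inE negb_and !negbK.
have vle e : e != a -> e != c -> v a + v c + v e <= n1.
  by rewrite -vn; apply: sum_three.
have ule e : e != a -> e != c -> u a + u c + u e <= n1.
  by rewrite -un; apply: sum_three.
have vac := vle b neq_ba neq_bc; have uac := ule b neq_ba neq_bc.
have [eps [ya [yc [eps1 y1 y2 y3 y4]]]] : exists eps ya yc,
    [/\ eps <= 1, ya + yc + eps = n2, v c + yc < v a + ya,
        u a + ya < u c + yc &
        0 < eps -> (0 < v a + v c) /\ (0 < u a + u c)].
  case/andP: sep => gap2 /orP[gap3|/andP[v0 u0]].
    (* The least [ya] with which [a] beats [c] against [v]. *)
    exists 0, (n2 + v c + 2 - v a)./2, (n2 - (n2 + v c + 2 - v a)./2).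
    by move: gap3 gap2; rewrite /gap; split; lia.
  (* The difference [ya - yc] is to be [v c - v a + 1], which fixes the parity of [n2 - eps]. *)
  exists (odd (n2 + v a + v c + 1)); case: (boolP (odd _)) => odd_n.
    exists ((n2 - 1 + v c + 2 - v a)./2),
      (n2 - 1 - (n2 - 1 + v c + 2 - v a)./2).
    by move: gap2 odd_n; rewrite /gap; split; lia.
  exists (n2 + v c + 2 - v a)./2, (n2 - (n2 + v c + 2 - v a)./2).
  by move: gap2 odd_n; rewrite /gap; split; lia.
(* The winner holds more than half of the joint votes of [a] and [c], which include [n2 - eps] votes
   cast here, and [n2] is at least [2 * (v a + v c + v e)]. If [eps] is 1, the votes already held by
   [a] and [c] compensate for it. *)
have bound e : e != a -> e != c ->
    v e + eps < v a + ya /\ u e + eps < u c + yc.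
  by move=> neq_ea neq_ec; have := vle e neq_ea neq_ec;
    have := ule e neq_ea neq_ec; case: (posnP eps) => [->|/y4]; lia.
pose y := [ffun e => if e == a then ya else if e == c then yc
                     else if e == b then eps else 0].
have ya_E : y a = ya by rewrite ffunE eqxx.
have yc_E : y c = yc by rewrite ffunE eqxx eq_sym (negPf neq_ac).
have y_le e : e != a -> e != c -> y e <= eps.
  by move=> /negPf ea /negPf ec; rewrite ffunE ea ec; case: ifP.
exists y.
  rewrite (bigD1 a) //= (bigD1 c) 1?eq_sym //= (bigD1 b) ?neq_ba //=.
  rewrite big1 => [|e /andP[/andP[/negPf ea /negPf ec] /negPf eb]].
    by rewrite ya_E yc_E ffunE (negPf neq_ba) (negPf neq_bc) eqxx; lia.
  by rewrite ffunE ea ec eb.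
split=> e neq_e; rewrite ?ya_E ?yc_E.
  case: (e =P c) => [->|/eqP neq_ec]; first by rewrite yc_E.
  by have := y_le e neq_e neq_ec; have := bound e neq_e neq_ec; lia.
case: (e =P a) => [->|/eqP neq_ea]; first by rewrite ya_E.
by have := y_le e neq_ea neq_e; have := bound e neq_ea neq_e; lia.
Qed.

Lemma sum_eq_lt u v : \sum_b u b = \sum_b v b ->
  (exists b, u b != v b) -> exists b, u b < v b.
Proof.
move=> eq_sum [b neq_b]; apply/existsP; apply: contraNT neq_b => /existsPn le_vu.
have le_vu' d : true -> v d <= u d ?= iff (u d == v d).
  by move=> _; split; [rewrite leqNgt le_vu|rewrite eq_sym].
have /leqif_sum[_] := le_vu'.
by rewrite eq_sum eqxx => /esym/forall_inP/(_ b isT).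
Qed.

Section Rows.
Variables (k l : nat) (M : 'I_k -> 'I_l -> A) (X : 'I_k -> A -> nat).

Definition meets i' i a c := [exists j, (M i' j == a) && (M i j == c)].

(* The bounds hold when [u] is the label of row [i]: [separated] rows must meet,
   whereas rows that meet have a nonnegative gap, which row [i] has with itself
   although it does not meet itself. *)
Definition row_ok i u := forall a c, a != c ->
  \sum_v separated (X v) u a c <= \sum_i' meets i' i a c
    < \sum_v gap 0 (X v) u a c.

(* If [u' a - u' c] exceeds [u a - u c] by 2 or more, then every vector counted
   in the upper bound for [u'] is counted in the lower bound for [u]. The only
   vectors that can fail this have no vote for [a] and [c]; exchanging the roles
   of [u] and [u'], and of [a] and [c], then avoids them. *)
Lemma row_ok_no_exchange i u u' a c :
  row_ok i u -> row_ok i u' -> u a < u' a -> u' c < u c -> False.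
Proof.
move=> ok ok' lt_a lt_c.
have neq_ac : a != c by apply: contraTneq lt_a => ->; lia.
case: (boolP (gap 3 u' u a c || (u a + 2 != u c))) => [far|].
  have := ok a c neq_ac; have := ok' a c neq_ac.
  suff: \sum_v gap 0 (X v) u' a c <= \sum_v separated (X v) u a c by lia.
  apply: leq_sum => v _; move: far; rewrite /separated /gap; lia.
(* Here [u c = u a + 2] and [u' a = u' c > 0], so after the swap every vector counted has votes for
   [c]. *)
move=> near; have neq_ca : c != a by rewrite eq_sym.
have := ok c a neq_ca; have := ok' c a neq_ca.
suff: \sum_v gap 0 (X v) u c a <= \sum_v separated (X v) u' c a by lia.
apply: leq_sum => v _; move: near; rewrite /separated /gap; lia.
Qed.

Lemma row_ok_inj i u u' : \sum_b u b = \sum_b u' b ->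
  row_ok i u -> row_ok i u' -> u =1 u'.
Proof.
move=> eq_sum ok ok' b; apply/eqP; apply: contraT => neq_b.
have [a lt_a] := sum_eq_lt eq_sum (ex_intro _ b neq_b).
have [|c lt_c] := sum_eq_lt (esym eq_sum); first by exists b; rewrite eq_sym.
by have := row_ok_no_exchange ok ok' lt_a lt_c.
Qed.

End Rows.
End Votes.

Section LabelledRows.
Variables (g : voting_form) (x : 'I_(nrows g) -> strategy (cand g) (alpha g)).
Variables (y : 'I_(ncols g) -> strategy (cand g) (beta g)).
Variable X : 'I_(nrows g) -> strategy (cand g) (alpha g).
Hypotheses (p3 : 3 <= #|cand g|) (le_ab : 2 * alpha g <= beta g).
Hypotheses (bijX : bijective X) (lab : labeling g x y).

(** Lower bound: a separating ballot labels some column, where [a] and [c] are the only winners.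
    Upper bound: at a common column the two winning conditions add up to a nonnegative gap, and row
    [i] itself makes the inequality strict. *)
Lemma labeling_row_ok i :
  row_ok (vmatrix g) (fun v => votes (X v)) i (votes (x i)).
Proof.
case: lab => bijx [y' yK y'K] AMxy a c neq_ac.
have win i' j b : votes (x i') b + votes (y j) b <=
    votes (x i') (vmatrix g i' j) + votes (y j) (vmatrix g i' j).
  by have := AMxy i' j; rewrite in_AM => /forallP.
(* [X] and [x] enumerate the same strategies, so sums over [X] become sums over rows. *)
have [s [s' sK s'K] sX] : exists2 s : 'I_(nrows g) -> 'I_(nrows g),
    bijective s & forall i', X (s i') = x i'.
  case: bijX => X' XK X'K; exists (X' \o x); last by move=> i'; apply: X'K.
  by apply: bij_comp => //; exists X.
have reindexX F : \sum_v F (votes (X v)) = \sum_i' F (votes (x i')).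
  rewrite (reindex s) /=; last by exists s' => i' _; [apply: sK|apply: s'K].
  by apply: eq_bigr => i' _; rewrite sX.
rewrite (reindexX (fun v => separated v (votes (x i)) a c : nat)).
rewrite (reindexX (fun v => gap 0 v (votes (x i)) a c : nat)).
apply/andP; split.
  apply: leq_sum => i' _; case: (boolP (separated _ _ _ _)) => // sep.
  have [z zn [win_a win_c]] :=
    separating_votes p3 le_ab (sum_votes (x i')) (sum_votes (x i)) neq_ac sep.
  have zP : \sum_b z b == beta g by apply/eqP.
  set j := y' (exist _ z zP).
  have yj b : votes (y j) b = z b by rewrite /votes y'K.
  suff -> : meets (vmatrix g) i' i a c by [].
  apply/existsP; exists j; apply/andP; split.
    apply: contraT => /win_a; have := win i' j a; rewrite !yj; lia.
  apply: contraT => /win_c; have := win i j c; rewrite !yj; lia.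
rewrite [X in X < _](bigD1 i) //= [X in _ < X](bigD1 i) //=.
have -> : meets (vmatrix g) i i a c = false.
  apply/negbTE/existsPn => j; apply: contra neq_ac.
  by case/andP=> /eqP <- /eqP <-.
have -> : gap 0 (votes (x i)) (votes (x i)) a c by rewrite /gap; lia.
rewrite add0n add1n ltnS; apply: leq_sum => i' _.
case: (boolP (meets _ _ _ _ _)) => // /existsP[j /andP[/eqP wa /eqP wc]].
have := win i' j c; have := win i j a; rewrite wa wc /gap; lia.
Qed.

End LabelledRows.

(** Both labels of row [i] pass the same test, taken with [x] itself as the enumeration of
    strategies. *)
Lemma labeling_rows_unique (g : voting_form) x x' y y' :
  3 <= #|cand g| -> 2 * alpha g <= beta g ->
  labeling g x y -> labeling g x' y' -> x =1 x'.
Proof.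
move=> p3 le_ab lab lab' i; have bijx : bijective x by case: lab.
apply: strategy_inj; apply: (row_ok_inj _ (labeling_row_ok p3 le_ab bijx lab i)
                     (labeling_row_ok p3 le_ab bijx lab' i)).
by rewrite !sum_votes.
Qed.

(** * Perfect matchings by auction *)

Section Auction.
Variables (l : nat) (adm : nat -> nat -> bool).
Implicit Types own price : nat -> nat.

(** Bidders are columns, items are strategies; [own y] is one plus the bidder that owns item [y], or
    0. *)
Definition unmatched own j := [forall y : 'I_l, own y != j.+1].

Definition matchable :=
  exists2 s : 'I_l -> 'I_l, injective s & forall j : 'I_l, adm j (s j).

(** [own_cheap] is complementary slackness up to the bid increment 1; [price_unowned] holds because
    an item once owned stays owned. *)
Record auction_inv own price : Prop := AuctionInv {
  own_le : forall y : 'I_l, own y <= l;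
  own_inj : forall y y' : 'I_l, own y != 0 -> own y = own y' -> y = y';
  own_adm : forall (y : 'I_l) j, own y = j.+1 -> adm j y;
  own_cheap : forall (y y' : 'I_l) j, own y = j.+1 -> adm j y' ->
    price y <= (price y').+1;
  price_unowned : forall y : 'I_l, own y = 0 -> price y = 0;
  price_le : matchable -> forall y : 'I_l, price y <= l
}.

(** If every bidder owned an item, all [l] items would be owned. *)
Lemma ex_unmatched own price : auction_inv own price ->
  (exists y : 'I_l, own y = 0) -> exists j : 'I_l, unmatched own j.
Proof.
move=> inv [y0 own0]; apply/existsP; apply: contraT => /existsPn no_free.
have item j : exists y : 'I_l, own y == (j : 'I_l).+1.
  by have /forallPn[y /negPn] := no_free j; exists y.
pose f j := xchoose (item j).
have fP j : own (f j) = j.+1 by apply/eqP/(xchooseP (item j)).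
have f_inj : injective f.
  by move=> j j' eq_f; apply: val_inj; have := fP j; rewrite eq_f fP => -[].
have /codomP[j eq_y0] := injF_onto f_inj y0.
by have := fP j; rewrite -eq_y0 own0.
Qed.

Lemma unowned_item own price (j : 'I_l) : auction_inv own price ->
  unmatched own j -> exists y : 'I_l, own y = 0.
Proof.
move=> inv /forallP free_j.
suff /existsP[y /eqP] : [exists y : 'I_l, own y == 0] by exists y.
apply: contraT => /existsPn owned.
have lt_own (y : 'I_l) : (own y).-1 < l.
  by have := owned y; have := own_le inv y; lia.
pose f y := Ordinal (lt_own y).
have f_inj : injective f.
  move=> y y' /(congr1 val) /= eq_f; apply: (own_inj inv); rewrite ?owned //.
  by have := owned y; have := owned y'; lia.
have /codomP[y /(congr1 val) /= eq_j] := injF_onto f_inj j.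
by have := free_j y; have := owned y; rewrite eq_j; lia.
Qed.

(* If all items admissible for a free bidder cost at least [l], then some price
   level [v] between 1 and [l] is not attained, because an item is unowned. The
   items above the gap are all owned, by bidders for whom, as for the free one,
   only items above the gap are admissible: Hall's condition fails. *)
Lemma cheap_item own price (j : 'I_l) : auction_inv own price -> matchable ->
  unmatched own j -> exists2 y : 'I_l, adm j y & price y < l.
Proof.
move=> inv [s s_inj adm_s] free_j; apply/exists_inP; apply: contraT.
move=> /exists_inPn dear.
have [y0 own0] := unowned_item inv free_j.
have [v /andP[v_gt0 le_vl] gap_v] : exists2 v, 0 < v <= l &
    forall y : 'I_l, price y != v.
  suff /existsP[v /forallP gap_v] :
      [exists v : 'I_l, forall y : 'I_l, price y != v.+1].
    by exists v.+1 => //=; apply: ltn_ord.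
  apply: contraT => /existsPn no_gap.
  have item v : exists y : 'I_l, price y == (v : 'I_l).+1.
    by have /forallPn[y /negPn] := no_gap v; exists y.
  pose f v := xchoose (item v).
  have fP v : price (f v) = v.+1 by apply/eqP/(xchooseP (item v)).
  have f_inj : injective f.
    by move=> v v' eq_f; apply: val_inj; have := fP v; rewrite eq_f fP => -[].
  have /codomP[v eq_y0] := injF_onto f_inj y0.
  by have := fP v; rewrite -eq_y0 (price_unowned inv own0).
pose S := [set y : 'I_l | v <= price y].
have owned y : y \in S -> own y != 0.
  by rewrite inE; apply: contraTneq => /(price_unowned inv) ->; rewrite -ltnNge.
pose B := [set b | [exists y in S, own y == (b : 'I_l).+1]].
have jB : j \notin B.
  rewrite inE; apply/exists_inPn => y _; exact: (forallP free_j).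
have cardB : #|S| <= #|B|.
  have lt_own (y : 'I_l) : (own y).-1 < l.
    by have := own_le inv y; have := ltn_ord y0; lia.
  pose f y := Ordinal (lt_own y).
  have f_inj : {in S &, injective f}.
    move=> y y' yS y'S /(congr1 val) /= eq_f.
    apply: (own_inj inv); rewrite ?owned //.
    by have := owned y yS; have := owned y' y'S; lia.
  rewrite -(card_in_imset f_inj); apply/subset_leq_card/subsetP => b.
  case/imsetP=> y yS ->; rewrite inE; apply/exists_inP; exists y => //=.
  by have := owned y yS; lia.
(* [s] maps the [#|B| + 1] bidders of [j |: B] injectively into [S], which is too small. *)
have : #|s @: (j |: B)| <= #|S|.
  apply/subset_leq_card/subsetP => z /imsetP[b]; rewrite !inE.
  case/predU1P=> [->|/exists_inP[y yS /eqP own_y]] ->.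
    by have := dear _ (adm_s j); lia.
  (* The slack of 1 is harmless: no price equals [v], so [y] costs at least [v + 1]. *)
  have := own_cheap inv own_y (adm_s b); have := gap_v y.
  by move: yS; rewrite inE; lia.
by rewrite card_imset // cardsU1 jB; lia.
Qed.

(** Item [y] was cheapest for [j], so after the raise it exceeds the other admissible items by at
    most 1. The bound [l] survives because [cheap_item] puts the old price of [y] below [l]. *)
Lemma auction_bid own price own' price' (j y : 'I_l) :
  auction_inv own price -> unmatched own j -> adm j y ->
  (forall y' : 'I_l, adm j y' -> price y <= price y') ->
  (forall z, own' z = if z == y then j.+1 else own z) ->
  (forall z, price' z = if z == y then (price y).+1 else price z) ->
  auction_inv own' price'.
Proof.
move=> inv free_j adm_jy cheap ownE priceE.
have free_neq z : own z = j.+1 -> z < l -> False.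
  by move=> own_z lt_z; have := forallP free_j (Ordinal lt_z); rewrite own_z eqxx.
split.
- by move=> z; rewrite ownE; case: ifP => // _; apply: own_le inv z.
- move=> z z'; rewrite !ownE.
  case: (z =P y :> nat) => [eq_z|_]; case: (z' =P y :> nat) => [eq_z'|_] //.
  + by move=> _ _; apply: val_inj; rewrite /= eq_z eq_z'.
  + by move=> _ /esym /free_neq; case.
  + by move=> _ /free_neq; case.
  + exact: own_inj inv z z'.
- move=> z i; rewrite ownE; case: (z =P y :> nat) => [-> [<-] //|_].
  exact: own_adm inv z i.
- move=> z z' i; rewrite ownE !priceE.
  case: (z =P y :> nat) => [_ [<-] /cheap le_y|_ own_z adm_z'].
    by case: (z' =P y :> nat) => _; lia.
  have := own_cheap inv own_z adm_z'.
  by case: (z' =P y :> nat) => [->|_]; lia.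
- move=> z; rewrite ownE priceE; case: eqP => // _; exact: price_unowned inv z.
- move=> mat z; rewrite priceE; case: eqP => [_|_]; last exact: price_le inv mat z.
  have [y' adm_y' lt_y'] := cheap_item inv mat free_j.
  by have := cheap y' adm_y'; lia.
Qed.

(** An unowned item costs 0, and the other [l - 1] items together at most [(l - 1) * l]. *)
Lemma auction_total own price : auction_inv own price -> matchable ->
  l * l <= \sum_(y < l) price y -> forall y : 'I_l, own y != 0.
Proof.
move=> inv mat big_sum y0; apply: contraL big_sum => /eqP own0.
rewrite -ltnNge (bigD1 y0) //= (price_unowned inv own0) add0n.
have : \sum_(y < l | y != y0) price y <= \sum_(y < l | y != y0) l.
  by apply: leq_sum => y _; apply: price_le inv mat y.
rewrite sum_nat_const cardC1 card_ord => /leq_ltn_trans; apply.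
by have := ltn_ord y0; rewrite ltn_mul2r; lia.
Qed.

End Auction.

(** * Listing all strategies *)

Notation "c1 ;; c2" := (CSeq c1 c2) (at level 90, right associativity).

Definition row_cell (x : nat) (i b : term) : term := TArr x (TAdd (TMul i 0) b).

(* Repeated prefix sums put ['C(n + #|A| - 1, #|A| - 1)] in cell [n] of array [w];
   the number of these values below dimension [q] is the number of votes. *)
Definition enum_init (w q : nat) : cmd :=
  CFor 0 q (CAssign w (TVar 0) (TConst 1)) ;;
  CFor 1 0 (CIf (FLt (TConst 0) (TVar 1))
    (CFor 0 q (CIf (FLt (TConst 0) (TVar 0))
      (CAssign w (TVar 0)
         (TAdd (TArr w (TVar 0)) (TArr w (TSub (TVar 0) (TConst 1)))))))) ;;
  (* This is coordinate 0 of row 0: the list starts with all votes on candidate 0. *)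
  CAssign w.+1 (TConst 0) (TSum 0 q (TInd (FLt (TArr w (TVar 0)) (TDim q)))) ;;
  CAssign w.+2 (TConst 0) (TConst 1).

(* [w.+2] holds the number of rows listed so far. The vector obtained from row
   [TVar 2] by moving a vote from candidate 0 to candidate [TVar 3] is written
   after the last row and kept if it is new. *)
Definition enum_move (w q : nat) : cmd :=
  let size := TArr w.+2 (TConst 0) in
  CFor 4 0 (CAssign w.+1 (TAdd (TMul size 0) (TVar 4))
    (TAdd (TSub (row_cell w.+1 (TVar 2) (TVar 4)) (TInd (FEq (TVar 4) (TConst 0))))
          (TInd (FEq (TVar 4) (TVar 3))))) ;;
  CIf (FNot (FEx 5 q (FAnd (FLt (TVar 5) size)
        (FAll 4 0 (FEq (row_cell w.+1 (TVar 5) (TVar 4)) (row_cell w.+1 size (TVar 4)))))))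
    (CAssign w.+2 (TConst 0) (TAdd size (TConst 1))).

(** One pass suffices: a vector found on the way is appended at the end and treated later in the
    same pass. *)
Definition enum_grow (w q : nat) : cmd :=
  CFor 2 q (CIf (FAnd (FLt (TVar 2) (TArr w.+2 (TConst 0)))
                      (FLt (TConst 0) (row_cell w.+1 (TVar 2) (TConst 0))))
    (CFor 3 0 (enum_move w q))).

Lemma row_index_lt s k p b : s < k -> b < p -> s * p + b < k * p.
Proof.
move=> lt_s lt_b; apply: (@leq_trans (s.+1 * p)); first by rewrite mulSn; lia.
by rewrite leq_mul2r lt_s orbT.
Qed.

(** * Correctness of the listing *)

Section Enumeration.
Variables (d : nat -> nat) (A : finType) (n q w : nat).
Hypotheses (A_gt1 : 1 < #|A|) (dA : d 0 = #|A|).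
Hypothesis dN : d q = 'C(n + #|A| - 1, #|A| - 1).

Lemma A_gt0 : 0 < #|A|. Proof. exact: ltnW. Qed.

Let a0 : A := enum_val (Ordinal A_gt0).

Lemma rank_a0 b : (enum_rank b == 0 :> nat) = (b == a0).
Proof.
apply/eqP/eqP => [eq0|->]; last by rewrite enum_valK.
by apply: (can_inj enum_rankK); apply: val_inj; rewrite enum_valK.
Qed.

Lemma sum_ltn_ord N k : \sum_(i < N) (i < k) = minn N k.
Proof.
elim: N => [|N IHN]; first by rewrite big_ord0 min0n.
by rewrite big_ord_recr /= IHN; lia.
Qed.

Lemma bin_lt p i j : 0 < p -> i < j -> 'C(i + p, p) < 'C(j + p, p).
Proof.
move=> p0; have lt_S k : 'C(k + p, p) < 'C(k.+1 + p, p).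
  case: p p0 => // p _; rewrite addSn binS -[X in X < _]addn0 ltn_add2l bin_gt0.
  by lia.
elim: j => // j IHj; rewrite ltnS leq_eqVlt => /predU1P[->//|/IHj lt_ij].
exact: ltn_trans lt_ij (lt_S j).
Qed.

Lemma enum_initP e m : (forall i, m w.+1 i = 0) ->
  let m' := crun d (enum_init w q) e m in
  m' w.+2 0 = 1 /\ forall i, m' w.+1 i = if i == 0 then n else 0.
Proof.
move=> m0; rewrite /enum_init; set c1 := CFor 0 q _; set c2 := CFor 1 0 _.
rewrite !crun_seq; set m1 := crun d c1 e m; set m2 := crun d c2 e m1.
rewrite !crun_assign; set m3 := update m2 _ _ _.
have m1E i : i < d q -> m1 w i = 1.
  move: i; apply: (crun_for (I := fun j m' => forall i, i < j -> m' w i = 1)) => //.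
  move=> j m' _ IH i; rewrite ltnS leq_eqVlt => /predU1P[->|lt_ij] /=.
    exact: update_eq.
  by rewrite update_neq ?IH //; lia.
have m2E i : i < d q -> m2 w i = 'C(i + #|A|.-1, #|A|.-1).
  rewrite -dA; move: i.
  (* Round 0 is skipped, so [r] rounds make [r.-1] prefix sums. *)
  apply: (crun_for (I := fun r m' =>
    forall i, i < d q -> m' w i = 'C(i + r.-1, r.-1))) => [i|r m' _ IH].
    by move/m1E->; rewrite bin0.
  set c3 := CFor 0 q _.
  rewrite crun_if [feval _ _ _ _]/=; case: (posnP r) => [r0|r_gt0]; first by rewrite r0 in IH *.
  (* The sums are formed in place: Pascal's rule adds the new left neighbour to the old value. *)
  pose I j m'' := forall i, i < d q ->
    m'' w i = if i < j then 'C(i + r, r) else 'C(i + r.-1, r.-1).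
  suff IE : I (d q) (crun d c3 (bind e 1 r) m') by move=> i lt_i; rewrite IE ?lt_i.
  apply: crun_for => [i lt_i|j m'' lt_j IHj i lt_i]; first by rewrite IH.
  rewrite /=; case: (posnP j) => [j0|j_gt0].
    rewrite IHj // j0 ltn0 ltnS leqn0; case: eqP => // ->.
    by rewrite !add0n !binn.
  rewrite /update eqxx /=; case: (i =P j) => [->|neq_ij]; last first.
    by rewrite IHj //; have -> : (i < j.+1) = (i < j) by lia.
  rewrite ltnSn !IHj //; last by lia.
  rewrite ltnn; have -> : j - 1 < j by lia.
  case: (j) j_gt0 => // i' _; case: (r) r_gt0 => // r' _.
  by rewrite /= subn1 /= [X in 'C(X, _) + _]addSnnS [in RHS]addSn binS addnC.
split=> [|i]; first exact: update_eq.
rewrite /= update_neq; last by lia.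
rewrite /m3 /update eqxx /=; case: eqP => [_|_]; last first.
  rewrite /m2 crun_frame ?inE; last by lia.
  by rewrite /m1 crun_frame ?inE ?m0 //; lia.
have pE : n + #|A| - 1 = n + #|A|.-1 by have := A_gt0; lia.
(* The binomials increase strictly, so exactly those of index below [n] are less than [d q]. *)
transitivity (\sum_(i < d q) (i < n)).
  apply: eq_bigr => j _; rewrite /= m2E // [ltnRHS]dN pE subn1.
  congr nat_of_bool.
  have p0 : 0 < #|A|.-1 by lia.
  case: (ltngtP j n) => [lt_jn|lt_nj|->]; last by rewrite ltnn.
    exact: bin_lt.
  by apply/negbTE; rewrite -leqNgt ltnW // bin_lt.
rewrite sum_ltn_ord dN pE subn1; apply/minn_idPr.
have p0 : 0 < #|A|.-1 by lia.
elim: (n) => // k IHk; apply: leq_ltn_trans IHk _; exact: bin_lt.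
Qed.

Definition vec (m : memory) (s : nat) : {ffun A -> nat} :=
  [ffun a => m w.+1 (s * #|A| + enum_rank a)].

Definition move (z : {ffun A -> nat}) (a : A) : {ffun A -> nat} :=
  [ffun b => z b - (b == a0) + (b == a)].

Definition listed m z := exists2 s, s < m w.+2 0 & vec m s = z.

Record enum_inv (m : memory) : Prop := EnumInv {
  enum_start : listed m [ffun b => if b == a0 then n else 0];
  enum_sum : forall s, s < m w.+2 0 -> \sum_a vec m s a = n;
  enum_inj : forall s s', s < m w.+2 0 -> s' < m w.+2 0 ->
    vec m s = vec m s' -> s = s'
}.

Definition enum_extends m m' :=
  m w.+2 0 <= m' w.+2 0 /\ forall s, s < m w.+2 0 -> vec m' s = vec m s.

Lemma enum_extends_listed m m' z :
  enum_extends m m' -> listed m z -> listed m' z.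
Proof.
by move=> [le_size eq_vec] [s lt_s <-]; exists s; [apply: leq_trans le_size|apply: eq_vec].
Qed.

(** The rows are distinct strategies; hence searches bounded by dimension [q] reach all of them. *)
Lemma enum_size_le m : enum_inv m -> m w.+2 0 <= d q.
Proof.
move=> inv; rewrite dN; have [E [E' EK E'K]] := strategy_bij n A_gt0.
pose f (s : 'I_(m w.+2 0)) := E' (to_strategy (enum_sum inv (ltn_ord s))).
suff f_inj : injective f by have := leq_card f f_inj; rewrite !card_ord.
move=> s s' /(can_inj E'K) /(congr1 val) /= eq_vec.
by apply: val_inj; apply: (enum_inj inv) => //; apply: ltn_ord.
Qed.

Lemma vecE m s (b : nat) (lt_b : b < #|A|) :
  m w.+1 (s * #|A| + b) = vec m s (enum_val (Ordinal lt_b)).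
Proof. by rewrite ffunE enum_valK. Qed.

Lemma sum_move (z : {ffun A -> nat}) a : 0 < z a0 -> \sum_b move z a b = \sum_b z b.
Proof.
move=> z0; have : \sum_b (move z a b + (b == a0)) = \sum_b (z b + (b == a)).
  apply: eq_bigr => b _; rewrite ffunE; case: (b =P a0) => [->|_]; last by lia.
  by lia.
have one c : \sum_(b : A) (b == c) = 1.
  by rewrite (bigD1 c) //= eqxx big1 ?addn0 // => b /negPf ->.
by rewrite !big_split /= !one => /addIn.
Qed.

(** The new vector is written just past the list, where it disturbs no listed row, and counts only
    once the size is increased. *)
Lemma enum_moveP e m : enum_inv m -> e 2 < m w.+2 0 ->
  0 < vec m (e 2) a0 -> forall lt_a : e 3 < #|A|,
  let m' := crun d (enum_move w q) e m in
  [/\ enum_inv m', enum_extends m m' &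
      listed m' (move (vec m (e 2)) (enum_val (Ordinal lt_a)))].
Proof.
move=> inv lt_t z0 lt_a; set z := vec m (e 2); set a := enum_val _.
rewrite /enum_move; set size := TArr w.+2 (TConst 0).
set c1 := CFor 4 0 _; set f := FNot _; rewrite crun_seq crun_if crun_assign.
set m1 := crun d c1 e m; set k := m w.+2 0.
have [new old] : (forall b, b < d 0 -> m1 w.+1 (k * d 0 + b) =
       m w.+1 (e 2 * d 0 + b) - (b == 0) + (b == e 3)) /\
    (forall y j, (y != w.+1) || (j < k * d 0) || (k * d 0 + d 0 <= j) ->
       m1 y j = m y j).
  apply: crun_row => m' b lt_b frm; split; rewrite /= frm //; first by lia.
  by rewrite row_index_lt ?orbT.
have m1_size : m1 w.+2 0 = k by rewrite old //; lia.
have vec_old s : s < k -> vec m1 s = vec m s.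
  move=> lt_s; apply/ffunP => b; rewrite !ffunE old // dA.
  by rewrite row_index_lt ?orbT.
have vec_new : vec m1 k = move z a.
  apply/ffunP => b; rewrite !ffunE.
  have := new (enum_rank b); rewrite dA => -> //; rewrite rank_a0.
  congr (_ - _ + nat_of_bool _).
  by rewrite -[RHS](inj_eq enum_rank_inj) enum_valK.
have inv1 : enum_inv m1.
  split; rewrite ?m1_size.
  - case: (enum_start inv) => s lt_s eq_s; exists s; first by rewrite m1_size.
    by rewrite vec_old.
  - by move=> s lt_s; rewrite vec_old // (enum_sum inv).
  - move=> s s' lt_s lt_s'; rewrite !vec_old //; apply: enum_inj inv _ _ lt_s lt_s'.
have ext1 : enum_extends m m1 by split; rewrite ?m1_size.
have fE : reflect (listed m1 (move z a)) (~~ feval d e m1 f).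
  rewrite /f /= negbK m1_size dA; apply: (iffP existsP) => [[s]|[s]].
    case/andP=> lt_s /forallP eq_s; exists s; first by rewrite m1_size.
    rewrite -vec_new; apply/ffunP => b; rewrite !ffunE.
    exact/eqP/(eq_s (enum_rank b)).
  rewrite m1_size => lt_s eq_s; have lt_sN : s < d q.
    exact: leq_trans lt_s (enum_size_le inv).
  exists (Ordinal lt_sN); rewrite /= lt_s /=; apply/forallP => b.
  by rewrite !(vecE m1 _ (ltn_ord b)) eq_s vec_new.
case: (boolP (feval d e m1 f)) => [f_true|/fE in_m1]; last by split.
have new_z : ~ listed m1 (move z a) by move/fE; rewrite f_true.
set m2 := update _ _ _ _.
have m2_size : m2 w.+2 0 = k.+1 by rewrite /m2 update_eq /= m1_size addn1.
have vec2 s : vec m2 s = vec m1 s.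
  by apply/ffunP => b; rewrite !ffunE /m2 update_neq //; lia.
split.
- split; rewrite ?m2_size.
  + case: (enum_start inv1) => s; rewrite m1_size => lt_s eq_s.
    by exists s; [rewrite m2_size ltnW | rewrite vec2].
  + move=> s; rewrite vec2 ltnS leq_eqVlt => /predU1P[->|lt_s].
      by rewrite vec_new sum_move // (enum_sum inv).
    by rewrite (enum_sum inv1) ?m1_size.
  + move=> s s'; rewrite !vec2 ltnS leq_eqVlt => /predU1P[->|lt_s];
      rewrite ltnS leq_eqVlt => /predU1P[->|lt_s'] // eq_vec.
    * by case: new_z; exists s'; rewrite ?m1_size // -eq_vec.
    * by case: new_z; exists s; rewrite ?m1_size // eq_vec.
    * by apply: (enum_inj inv1); rewrite ?m1_size.
- by split=> [|s lt_s]; rewrite ?m2_size // vec2 vec_old.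
- by exists k; rewrite ?m2_size // vec2.
Qed.

Lemma enum_growP e m : enum_inv m ->
  let m' := crun d (enum_grow w q) e m in
  enum_inv m' /\ forall z a, listed m' z -> 0 < z a0 -> listed m' (move z a).
Proof.
move=> inv m'.
(* Listed rows never change, so moves already treated stay treated. *)
pose I t m1 := enum_inv m1 /\ forall s a, s < t -> s < m1 w.+2 0 ->
  0 < vec m1 s a0 -> listed m1 (move (vec m1 s) a).
suff [inv' closed] : I (d q) m'.
  split=> // _ a [s lt_s <-] z0; apply: closed => //.
  by apply: leq_trans lt_s _; apply: enum_size_le.
apply: crun_for => [|t m1 lt_t [inv1 closed1]]; first by split.
set body := CFor 3 0 _.
rewrite crun_if [feval _ _ _ _]/=.
have rank0 : vec m1 t a0 = m1 w.+1 (t * d 0 + 0).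
  by rewrite ffunE enum_valK dA.
case: ifP => [/andP[lt_size]|]; rewrite -rank0; last first.
  move=> skip; split=> // s a; rewrite ltnS leq_eqVlt => /predU1P[->|].
    by move=> lt_s z0; rewrite lt_s z0 in skip.
  exact: closed1.
move=> z0; set m2 := crun d body _ _.
pose J r m3 := [/\ enum_inv m3, enum_extends m1 m3 &
  forall b (lt_b : b < #|A|), b < r ->
    listed m3 (move (vec m1 t) (enum_val (Ordinal lt_b)))].
have [inv2 ext2 new2] : J (d 0) m2.
  apply: crun_for => [|r m3]; first by split; [|split|].
  rewrite {1}dA => lt_r [inv3 ext3 new3].
  have vec3 : vec m3 t = vec m1 t by apply: (proj2 ext3).
  have lt_t3 : t < m3 w.+2 0 by apply: leq_trans (proj1 ext3).
  have [|inv4 ext4 new4] := enum_moveP (e := bind (bind e 2 t) 3 r) inv3 lt_t3 _ lt_r.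
    by rewrite /= vec3.
  rewrite /= vec3 in new4; split=> //.
    split=> [|s lt_s]; first exact: leq_trans (proj1 ext3) (proj1 ext4).
    rewrite (proj2 ext4) ?(proj2 ext3) //; exact: leq_trans (proj1 ext3).
  move=> b lt_b; rewrite ltnS leq_eqVlt => /predU1P[eq_b|lt_br].
    by congr listed: new4; congr move; congr enum_val; apply: val_inj.
  exact: enum_extends_listed ext4 (new3 b lt_b lt_br).
split=> // s a lt_s _ ; have lt_s1 : s < m1 w.+2 0.
  by move: lt_s; rewrite ltnS => /leq_ltn_trans; apply.
rewrite (proj2 ext2) // => zs; move: lt_s; rewrite ltnS leq_eqVlt => /predU1P[->|lt_s].
  have := new2 _ (ltn_ord (enum_rank a)); rewrite dA.
  have -> : Ordinal (ltn_ord (enum_rank a)) = enum_rank a by apply: val_inj.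
  by rewrite enum_rankK; apply.
by apply: enum_extends_listed ext2 _; apply: closed1.
Qed.

(** Induction on the votes outside candidate 0: giving one of them back to candidate 0 yields a
    listed vector, from which a move recovers [z]. *)
Lemma enum_complete m : enum_inv m ->
  (forall z a, listed m z -> 0 < z a0 -> listed m (move z a)) ->
  exists2 X : 'I_(d q) -> strategy A n, bijective X &
    forall (u : 'I_(d q)) a, m w.+1 (u * #|A| + enum_rank a) = votes (X u) a.
Proof.
move=> inv closed.
have all_listed (z : {ffun A -> nat}) : \sum_a z a = n -> listed m z.
  have [k] := ubnP (n - z a0); elim: k z => // k IHk z lt_k sum_z.
  case: (boolP [exists a, (a != a0) && (0 < z a)]) => [/existsP[a]|/existsPn none].
    case/andP=> neq_a za; pose z' := [ffun b => z b + (b == a0) - (b == a)].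
    have zE : move z' a = z.
      apply/ffunP => b; rewrite !ffunE.
      by case: (b =P a) => [->|_]; case: (b =P a0) => _ /=; lia.
    have z'0 : z' a0 = (z a0).+1.
      by rewrite ffunE eqxx eq_sym (negPf neq_a); lia.
    have le_n : z a0 < n by rewrite -sum_z (bigD1 a0) //= (bigD1 a) //=; lia.
    rewrite -zE; apply: closed; last by rewrite z'0.
    apply: IHk; first by rewrite z'0; lia.
    by rewrite -(@sum_move z' a) ?zE // z'0.
  suff -> : z = [ffun b => if b == a0 then n else 0] by apply: enum_start inv.
  have z0 b : b != a0 -> z b = 0.
    by move=> neq_b; have := none b; rewrite neq_b /=; lia.
  apply/ffunP => b; rewrite ffunE; case: eqP => [->|/eqP /z0 //].
  by rewrite -sum_z (bigD1 a0) //= big1 ?addn0.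
have le_N : d q <= m w.+2 0.
  rewrite dN; have [E [E' EK E'K]] := strategy_bij n A_gt0.
  have ind i : exists s : 'I_(m w.+2 0), vec m s == val (E i).
    have [s lt_s eq_s] := all_listed _ (sum_votes (E i)).
    by exists (Ordinal lt_s); rewrite eq_s.
  pose f i := xchoose (ind i).
  suff f_inj : injective f by have := leq_card f f_inj; rewrite !card_ord.
  move=> i i' eq_f; apply: (can_inj EK); apply: val_inj.
  have /eqP <- := xchooseP (ind i); have /eqP <- := xchooseP (ind i').
  by rewrite -/(f i) -/(f i') eq_f.
have lt_size (u : 'I_(d q)) : u < m w.+2 0 by apply: leq_trans le_N.
pose X u := to_strategy (enum_sum inv (lt_size u)).
exists X; last by move=> u a; rewrite /votes /= ffunE.
apply: bijective_finite => [u u' /(congr1 val) /= eq_vec|z].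
  by apply: val_inj; apply: (enum_inj inv) => //; apply: lt_size.
have [s lt_s eq_s] := all_listed _ (sum_votes z).
have lt_sN := leq_trans lt_s (enum_size_le inv).
by exists (Ordinal lt_sN); apply: val_inj.
Qed.

Lemma enumP e m : (forall i, m w.+1 i = 0) ->
  let m' := crun d (enum_init w q ;; enum_grow w q) e m in
  exists2 X : 'I_(d q) -> strategy A n, bijective X &
    forall (u : 'I_(d q)) a, m' w.+1 (u * #|A| + enum_rank a) = votes (X u) a.
Proof.
move=> m0 m'; have [size1 start] := enum_initP e m0.
have inv : enum_inv (crun d (enum_init w q) e m).
  have vec0 : vec (crun d (enum_init w q) e m) 0 =
      [ffun b => if b == a0 then n else 0].
    by apply/ffunP => b; rewrite !ffunE start rank_a0.
  split; rewrite ?size1.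
  - by exists 0; rewrite ?size1.
  - case=> // _; rewrite vec0 (bigD1 a0) //= ffunE eqxx big1 ?addn0 // => b.
    by rewrite ffunE => /negPf ->.
  - by case=> // -[].
have [inv' closed] := enum_growP e inv.
exact: enum_complete.
Qed.

End Enumeration.

(** * The recognition program *)

(* Arrays: 8 and 11 list the strategies of the two voters, 3 receives the row
   labels and 4 the column labels. Array 13 holds, for each strategy of the
   second voter, one plus the column that owns it (0 if there is none), and array
   14 its price. *)
Definition entry (i j : term) : term := TArr 1 (TAdd (TMul i 2) j).

(** In the forms for the row test, variables 0 and 5 are the rows [i] and [i'], 6 a column, 1 and 4
    the strategies [u] and [v], 2 and 3 the candidates [a] and [c]. *)
Definition gap_form (h : nat) : form :=
  FLe (TAdd (TAdd (row_cell 8 (TVar 1) (TVar 2)) (row_cell 8 (TVar 4) (TVar 3))) (TConst h))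
      (TAdd (row_cell 8 (TVar 4) (TVar 2)) (row_cell 8 (TVar 1) (TVar 3))).

Definition separated_form : form :=
  FAnd (gap_form 2) (FOr (gap_form 3)
    (FAnd (FLt (TConst 0) (TAdd (row_cell 8 (TVar 4) (TVar 2)) (row_cell 8 (TVar 4) (TVar 3))))
          (FLt (TConst 0) (TAdd (row_cell 8 (TVar 1) (TVar 2)) (row_cell 8 (TVar 1) (TVar 3)))))).

Definition row_ok_form : form :=
  let met := TSum 5 1 (TInd (FEx 6 2
    (FAnd (FEq (entry (TVar 5) (TVar 6)) (TVar 2))
          (FEq (entry (TVar 0) (TVar 6)) (TVar 3))))) in
  FAll 2 0 (FAll 3 0 (FOr (FEq (TVar 2) (TVar 3))
    (FAnd (FLe (TSum 4 1 (TInd separated_form)) met)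
          (FLt met (TSum 4 1 (TInd (gap_form 0))))))).

Definition label_rows : cmd :=
  CFor 0 1 (CFor 1 1 (CIf row_ok_form
    (CFor 7 0 (CAssign 3 (TAdd (TMul (TVar 0) 0) (TVar 7)) (row_cell 8 (TVar 1) (TVar 7)))))).

Definition admissible_form (y : nat) : form :=
  let won := entry (TVar 3) (TVar 0) in
  FAll 3 1 (FAll 4 0
    (FLe (TAdd (row_cell 3 (TVar 3) (TVar 4)) (row_cell 11 (TVar y) (TVar 4)))
         (TAdd (row_cell 3 (TVar 3) won) (row_cell 11 (TVar y) won)))).

(* Column [TVar 0] owns nothing and strategy [TVar 1] is a cheapest one among
   those admissible for it. *)
Definition bid_form : form :=
  FAnd (FAll 2 2 (FNot (FEq (TArr 13 (TVar 2)) (TAdd (TVar 0) (TConst 1)))))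
  (FAnd (admissible_form 1)
        (FAll 2 2 (FOr (FNot (admissible_form 2))
                       (FLe (TArr 14 (TVar 1)) (TArr 14 (TVar 2)))))).

Definition bid : cmd :=
  CIf bid_form
    (CAssign 13 (TVar 1) (TAdd (TVar 0) (TConst 1)) ;;
     CAssign 14 (TVar 1) (TAdd (TArr 14 (TVar 1)) (TConst 1))).

Definition sweep : cmd := CFor 0 2 (CFor 1 2 bid).

Definition auction : cmd := CFor 8 2 (CFor 9 2 sweep).

Definition label_columns : cmd :=
  CFor 0 2 (CIf (FLt (TConst 0) (TArr 13 (TVar 0)))
    (CFor 7 0 (CAssign 4
      (TAdd (TMul (TSub (TArr 13 (TVar 0)) (TConst 1)) 0) (TVar 7))
      (row_cell 11 (TVar 0) (TVar 7))))).

(** Owned strategies are admissible for their columns by the auction invariant, so once every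
    strategy of the first voter labels a row and every one of the second is owned, a labeling has
    been found. *)
Definition answer_form : form :=
  FAnd (FAll 1 1 (FEx 0 1 (FAll 7 0
         (FEq (row_cell 3 (TVar 0) (TVar 7)) (row_cell 8 (TVar 1) (TVar 7))))))
       (FAll 0 2 (FLt (TConst 0) (TArr 13 (TVar 0)))).

Definition enumerate (w q : nat) : cmd := enum_init w q ;; enum_grow w q.

Definition recognize : cmd :=
  enumerate 7 1 ;; enumerate 10 2 ;; label_rows ;; auction ;; label_columns ;;
  CAssign 2 (TConst 0) (TInd answer_form).

(** * Correctness of the recognition program *)

Lemma recognize_wf : cwf [::] recognize. Proof. by []. Qed.

Lemma forall_rank (A : finType) (P : pred 'I_#|A|) :
  [forall i, P i] = [forall a, P (enum_rank a)].
Proof.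
apply/forallP/forallP => [all_P a|all_P i]; first exact: all_P.
by rewrite -(enum_valK i).
Qed.

Lemma nth_allpairs_row (R S : Type) (f : R -> S -> nat) r0 s0 rs ss i j :
  i < size rs -> j < size ss ->
  nth 0 [seq f r s | r <- rs, s <- ss] (i * size ss + j) = f (nth r0 rs i) (nth s0 ss j).
Proof.
move=> lt_i lt_j; elim: rs i lt_i => // r rs IHrs [|i] lt_i /=.
  by rewrite mul0n nth_cat size_map lt_j (nth_map s0).
rewrite nth_cat size_map mulSn -addnA ltnNge leq_addr /= addKn.
exact: IHrs.
Qed.

Lemma input_entry (g : voting_form) (i : 'I_(nrows g)) (j : 'I_(ncols g)) :
  input g 1 (i * ncols g + j) = enum_rank (vmatrix g i j).
Proof.
have := nth_allpairs_row (fun r c => enum_rank (vmatrix g r c) : nat) i j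
  (rs := enum 'I_(nrows g)) (ss := enum 'I_(ncols g)) (i := i) (j := j).
by rewrite !size_enum_ord !nth_ord_enum; apply.
Qed.

Section Recognition.
Variable g : voting_form.
Hypothesis p3 : 3 <= #|cand g|.
Let d := dims g.
Let p := #|cand g|.
Let k := nrows g.
Let l := ncols g.

Definition lists N (m : memory) (x : nat) (X : 'I_N -> cand g -> nat) :=
  forall (u : 'I_N) a, m x (u * p + enum_rank a) = X u a.

Definition has_entries (m : memory) :=
  forall (i : 'I_k) (j : 'I_l), m 1 (i * l + j) = enum_rank (vmatrix g i j).

Section Rows.
Variable X : 'I_k -> strategy (cand g) (alpha g).
Hypothesis bijX : bijective X.

Lemma row_ok_formP (e : nat -> nat) m (i u : 'I_k) : e 0 = i -> e 1 = u ->
  has_entries m -> lists m 8 (fun u => votes (X u)) ->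
  reflect (row_ok (vmatrix g) (fun v => votes (X v)) i (votes (X u)))
    (feval d e m row_ok_form).
Proof.
move=> e0 e1 mG mX.
have -> : feval d e m row_ok_form = [forall a, [forall c, (a == c) ||
   ((\sum_v separated (votes (X v)) (votes (X u)) a c <=
     \sum_i' meets (vmatrix g) i' i a c) &&
    (\sum_i' meets (vmatrix g) i' i a c <
     \sum_v gap 0 (votes (X v)) (votes (X u)) a c))]].
  rewrite /= /d /= forall_rank; apply: eq_forallb => a.
  rewrite forall_rank; apply: eq_forallb => c.
  rewrite -/p e0 e1.
  have metE : \sum_(i' < nrows g) [exists j : 'I_(ncols g),
      (m 1 (i' * ncols g + j) == enum_rank a) &&
      (m 1 (i * ncols g + j) == enum_rank c)] =
      \sum_i' meets (vmatrix g) i' i a c.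
    apply: eq_bigr => i' _; congr nat_of_bool; apply: eq_existsb => j.
    by rewrite !mG !(inj_eq val_inj) !(inj_eq enum_rank_inj).
  rewrite metE (inj_eq val_inj) (inj_eq enum_rank_inj); congr (_ || (_ <= _) && (_ < _)).
    by apply: eq_bigr => v _; rewrite !mX.
  by apply: eq_bigr => v _; rewrite !mX.
apply: (iffP forallP) => [ok a c neq_ac|ok a].
  by have /forallP/(_ c) := ok a; rewrite (negPf neq_ac).
by apply/forallP => c; case: eqP => //= /eqP; apply: ok.
Qed.


(** By [row_ok_inj] any strategy passing the test for row [i] is [x i], so repeated writes do no
    harm, and [x i] is among those tried. *)
Lemma label_rowsP e m x (y : 'I_l -> strategy (cand g) (beta g)) :
  2 * alpha g <= beta g -> labeling g x y ->
  has_entries m -> lists m 8 (fun u => votes (X u)) ->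
  lists (crun d label_rows e m) 3 (fun i => votes (x i)).
Proof.
move=> le_ab lab mG mX; set m' := crun d label_rows e m.
pose other m1 := forall z j, z != 3 -> m1 z j = m z j.
pose done_row m1 (i : 'I_k) := forall a, m1 3 (i * p + enum_rank a) = votes (x i) a.
pose I i m1 := other m1 /\ forall i' : 'I_k, i' < i -> done_row m1 i'.
suff [_ rows] : I k m' by move=> i a; apply: rows.
apply: (@crun_for d I 0 1) => [|i m1 lt_i [oth1 done1]]; first by split.
pose i' : 'I_k := Ordinal lt_i; set m2 := crun _ _ _ _.
pose J u m3 := [/\ other m3, forall i1 : 'I_k, i1 < i -> done_row m3 i1 &
  forall v : 'I_k, v < u -> X v = x i' -> done_row m3 i'].
have [oth2 done2 new2] : J k m2.
  apply: (@crun_for d J 1 1) => [|u m3 lt_u [oth3 done3 new3]]; first by split.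
  rewrite crun_if; set e' := bind _ 1 u; pose u' : 'I_k := Ordinal lt_u.
  have e0 : e' 0 = i' by [].
  have e1 : e' 1 = u' by [].
  have G3 : has_entries m3 by move=> *; rewrite oth3.
  have X3 : lists m3 8 (fun u => votes (X u)) by move=> v a; rewrite oth3.
  have okP := row_ok_formP e0 e1 G3 X3.
  have okx : row_ok (vmatrix g) (fun v => votes (X v)) i' (votes (x i')).
    exact: labeling_row_ok p3 le_ab bijX lab i'.
  case: okP => [ok|not_ok]; last first.
    split=> // v; rewrite ltnS leq_eqVlt => /predU1P[eq_v|]; last exact: new3.
    have -> : v = u' by apply: val_inj.
    by move=> eq_x; rewrite eq_x in not_ok.
  have eq_x : votes (X u') =1 votes (x i').
    by apply: row_ok_inj ok okx; rewrite !sum_votes.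
  pose w b := m3 8 (u * p + b).
  have [new old] := @crun_row d 7 3 (TVar 0) (row_cell 8 (TVar 1) (TVar 7)) e' m3 i w
    (fun m4 b lt_b frm => conj (erefl i) (frm 8 (u * p + b) isT)).
  have new_row m4 : (forall b, b < d 0 -> m4 3 (i * d 0 + b) = w b) -> done_row m4 i'.
    move=> new4 a; rewrite [LHS]new4 //.
    by rewrite /w -[u]/(u' : nat) X3 eq_x.
  split.
  - by move=> z j z3; rewrite old ?z3 // oth3.
  - move=> i1 lt_i1 a; rewrite old ?done3 //.
    by rewrite row_index_lt ?orbT.
  - by move=> v _ _; apply: new_row.
split=> // i1; rewrite ltnS leq_eqVlt => /predU1P[eq_i|]; last exact: done2.
have -> : i1 = i' by apply: val_inj.
have [X' XK X'K] := bijX.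
by apply: (new2 (X' (x i')) (ltn_ord _)); rewrite X'K.
Qed.

End Rows.

(** Only arrays 1, 3 and 11 are read; the auction leaves them alone, so admissibility is fixed
    throughout. *)
Definition admissible (m : memory) (j y : nat) : bool :=
  [forall i : 'I_k, [forall c : 'I_p,
     m 3 (i * p + c) + m 11 (y * p + c) <=
     m 3 (i * p + m 1 (i * l + j)) + m 11 (y * p + m 1 (i * l + j))]].

Lemma admissibleP m N (x : 'I_k -> cand g -> nat) (Y : 'I_N -> cand g -> nat)
    (j : 'I_l) (y : 'I_N) :
  has_entries m -> lists m 3 x -> lists m 11 Y ->
  admissible m j y =
  [forall i, vmatrix g i j \in AM (fun a => (x i a)%:Z + (Y y a)%:Z)%R].
Proof.
move=> mG mx mY; apply: eq_forallb => i; rewrite in_AM forall_rank.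
by apply: eq_forallb => c; rewrite mG !mx !mY.
Qed.

Section Auction.
Variable m0 : memory.
Hypothesis own0 : forall i, m0 13 i = 0.
Hypothesis price0 : forall i, m0 14 i = 0.

Let adm := admissible m0.
Let inv m := auction_inv l adm (m 13) (m 14) /\
  forall z i, z \notin [:: 13; 14] -> m z i = m0 z i.
Let total (m : memory) := \sum_(y < l) m 14 y.

Lemma bid_formP (e : nat -> nat) m (j y : nat) : inv m -> e 0 = j -> e 1 = y ->
  reflect [/\ unmatched l (m 13) j, adm j y &
    forall y' : 'I_l, adm j y' -> m 14 y <= m 14 y']
  (feval d e m bid_form).
Proof.
move=> [_ frame] e0 e1.
have admE z : admissible m j z = adm j z.
  by apply: eq_forallb => i; apply: eq_forallb => c; rewrite !frame.
have -> : feval d e m bid_form = [&& unmatched l (m 13) j, adm j y &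
    [forall y' : 'I_l, ~~ adm j y' || (m 14 y <= m 14 y')]].
  rewrite /= -/d e0 e1; congr [&& _, _ & _].
  - by apply: eq_forallb => z; rewrite addn1.
  - exact: admE.
  - by apply: eq_forallb => z; rewrite -admE.
apply: (iffP and3P) => -[fr ad cheap]; split=> //.
  by move=> y' ad'; have /forallP/(_ y') := cheap; rewrite ad'.
by apply/forallP => y'; case: (boolP (adm j y')) => //= /cheap.
Qed.

(** The total price measures progress. Without a bid the memory is unchanged, which lets [sweepP]
    argue about the start of the sweep. *)
Lemma bidP (e : nat -> nat) m (j y : 'I_l) : inv m -> e 0 = j -> e 1 = y ->
  let m' := crun d bid e m in
  [/\ inv m', forall z, m 13 z != 0 -> m' 13 z != 0 &
      total m < total m' \/ m' = m /\ ~~ feval d e m bid_form].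
Proof.
move=> inv_m e0 e1 m'; rewrite {}/m' /bid crun_if.
case: (bid_formP inv_m e0 e1) => [[fr ad cheap]|no_bid]; last first.
  by split=> //; right.
rewrite crun_seq !crun_assign /= e0 e1.
set m' := update _ _ _ _; have [inv_own frame] := inv_m.
have ownE z : m' 13 z = if z == y then j.+1 else m 13 z.
  by rewrite /m' /update /= addn1.
have priceE z : m' 14 z = if z == y then (m 14 y).+1 else m 14 z.
  by rewrite /m' /update /= addn1.
split.
- split; first exact: auction_bid inv_own fr ad cheap ownE priceE.
  move=> z i z1314; rewrite /m' /update.
  by move: (z1314); rewrite !inE => /norP[/negPf -> /negPf ->]; apply: frame.
- by move=> z owned; rewrite ownE; case: ifP.
- left; rewrite /total (bigD1 y) //= [X in _ < X](bigD1 y) //= priceE eqxx.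
  rewrite addSn ltnS leq_add2l; apply: leq_sum => z /negPf neq_z.
  by rewrite priceE (inj_eq val_inj) neq_z.
Qed.

(** A sweep that does not raise the total made no bid, so none was possible; but if a perfect
    matching exists, a free bidder always has a cheapest admissible item. *)
Lemma sweepP e m : inv m ->
  let m' := crun d sweep e m in
  [/\ inv m', forall z, m 13 z != 0 -> m' 13 z != 0 &
      matchable l adm -> total m < total m' \/ forall y : 'I_l, m' 13 y != 0].
Proof.
move=> inv_m m'.
pose K j m1 := [/\ inv m1, forall z, m 13 z != 0 -> m1 13 z != 0 &
  total m < total m1 \/ m1 = m /\ forall (j' y : 'I_l), j' < j ->
    ~~ [&& unmatched l (m 13) j', adm j' y &
        [forall y' : 'I_l, adm j' y' ==> (m 14 y <= m 14 y')]]].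
have [inv' owned' prog] : K l m'.
  apply: (@crun_for d K 0 2) => [|j m1 lt_j [inv1 owned1 prog1]].
    by split=> //; right.
  pose j0 : 'I_l := Ordinal lt_j.
  pose K' y m2 := [/\ inv m2, forall z, m 13 z != 0 -> m2 13 z != 0 &
    total m < total m2 \/ m2 = m /\ forall (j' y' : 'I_l),
      (j' < j) || (j' == j :> nat) && (y' < y) ->
      ~~ [&& unmatched l (m 13) j', adm j' y' &
        [forall z : 'I_l, adm j' z ==> (m 14 y' <= m 14 z)]]].
  set m2 := crun _ _ _ _.
  have [inv2 owned2 prog2] : K' l m2.
    apply: (@crun_for d K' 1 2) => [|y m3 lt_y [inv3 owned3 prog3]].
      split=> //; case: prog1 => [|[-> none]]; [by left|right; split=> // j' y'].
      by rewrite andbF orbF; apply: none.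
    pose y0 : 'I_l := Ordinal lt_y.
    set e' := bind _ 1 y.
    have [inv4 owned4 prog4] := @bidP e' m3 j0 y0 inv3 erefl erefl.
    split=> //; first by move=> z /owned3 /owned4.
    case: prog4 => [lt4|[-> no_bid]].
      left; case: prog3 => [lt3|[eq3 _]]; first exact: ltn_trans lt4.
      by rewrite -eq3.
    case: prog3 => [lt3|[eq3 none]]; [by left|right; split=> // j' y' pos].
    rewrite eq3 in no_bid inv3.
    case: (boolP ((j' < j) || (j' == j :> nat) && (y' < y))) => [/none //|not_pos].
    have -> : j' = j0 by apply: val_inj => /=; lia.
    have -> : y' = y0 by apply: val_inj => /=; lia.
    apply: contra no_bid => /and3P[fr ad /forallP cheap].
    apply/(@bid_formP e' m j0 y0) => //; split=> // z adz.
    by have /implyP := cheap z; apply.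
  split=> //; case: prog2 => [|[-> none]]; [by left|right; split=> // j' y lt_j'].
  by apply: none; rewrite ltn_ord andbT; lia.
split=> // mat; case: prog => [|[eq_m none]]; [by left|right=> y; rewrite eq_m].
apply/negP => /eqP own_y; have [inv_own _] := inv_m.
have [j free_j] := ex_unmatched inv_own (ex_intro _ y own_y).
have [y1 ad1 _] := cheap_item inv_own mat free_j.
pose y2 := [arg min_(z < y1 | adm j z) m 14 z].
have [ad2 min2] : adm j y2 /\ forall z : 'I_l, adm j z -> m 14 y2 <= m 14 z.
  by rewrite /y2; case: arg_minnP.
have /negP[] := none j y2 (ltn_ord j); rewrite free_j ad2.
by apply/forallP => z; apply/implyP; apply: min2.
Qed.

(** If a perfect matching exists, each of the [l * l] sweeps raises the total unless all items are
    owned, a state that persists. *)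
Lemma auctionP e : let m' := crun d auction e m0 in
  auction_inv l adm (m' 13) (m' 14) /\
  (matchable l adm -> forall y : 'I_l, m' 13 y != 0).
Proof.
move=> m'.
pose J r m := inv m /\
  (matchable l adm -> r <= total m \/ forall y : 'I_l, m 13 y != 0).
have [[inv' _] prog] : J (l * l) m'.
  pose I r m := J (r * l) m.
  apply: (@crun_for d I 8 2) => [|r m lt_r Jm].
    split; last by left.
    split=> //.
    by split=> [y|y y'|y j|y y' j|y|_ y]; rewrite ?own0 ?price0.
  rewrite /I mulSn addnC.
  apply: (@crun_for d (fun s => J (r * l + s)) 9 2) => [|s m1 lt_s [inv1 prog1]].
    by rewrite addn0.
  have [inv2 owned2 prog2] := sweepP (bind (bind e 8 r) 9 s) inv1.
  split=> // mat; case: (prog2 mat) => [lt2|]; last by right.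
  case: (prog1 mat) => [le1|all1]; first by left; rewrite addnS; apply: leq_ltn_trans lt2.
  by right=> y; apply: owned2.
split=> // mat; case: (prog mat) => // big_total.
exact: auction_total inv' mat big_total.
Qed.

End Auction.


(** No column label is overwritten, because a column owns at most one strategy. *)
Lemma label_columnsP e m price N (Y : 'I_l -> cand g -> nat) :
  auction_inv l N (m 13) price -> lists m 11 Y ->
  forall (y j : 'I_l), m 13 y = j.+1 ->
  forall a, crun d label_columns e m 4 (j * p + enum_rank a) = Y y a.
Proof.
move=> inv mY; set m' := crun d label_columns e m.
pose I i m1 := (forall z t, z != 4 -> m1 z t = m z t) /\
  forall y j : 'I_l, y < i -> m 13 y = j.+1 ->
  forall a, m1 4 (j * p + enum_rank a) = Y y a.
suff [_ cols] : I l m' by move=> y j; apply: cols.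
apply: (@crun_for d I 0 2) => [|i m1 lt_i [oth1 cols1]]; first by split.
rewrite crun_if [feval _ _ _ _]/=; set e' := bind e 0 i.
pose i' : 'I_l := Ordinal lt_i.
have -> : m1 13 i = m 13 i' by rewrite oth1.
case: (posnP (m 13 i')) => [own0|own_gt0].
  split=> // y j; rewrite ltnS leq_eqVlt => /predU1P[eq_y|]; last exact: cols1.
  by have -> : y = i' by [apply: val_inj]; rewrite own0.
pose w b := m 11 (i * p + b).
have [new old] := @crun_row d 7 4 (TSub (TArr 13 (TVar 0)) (TConst 1))
  (row_cell 11 (TVar 0) (TVar 7)) e' m1 (m 13 i').-1 w
  (fun m4 b lt_b frm => conj
     (etrans (congr1 (subn^~ 1) (etrans (frm 13 i isT) (oth1 13 i isT))) (subn1 _))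
     (etrans (frm 11 (i * p + b) isT) (oth1 11 (i * p + b) isT))).
split=> [z t z4|y j]; first by rewrite old ?z4 // oth1.
rewrite ltnS leq_eqVlt => /predU1P[eq_y|lt_y] own_y a.
  have eq_yi : y = i' by apply: val_inj.
  have eq_j : (m 13 i').-1 = j by rewrite -eq_yi own_y.
  by rewrite eq_j in new; rewrite [LHS]new // /w -[i]/(i' : nat) mY eq_yi.
rewrite old; first exact: cols1.
have neq_j : j != (m 13 i').-1 :> nat.
  apply: contraTneq lt_y => eq_j; rewrite -leqNgt.
  have -> : y = i' by apply: (own_inj inv); rewrite own_y //; lia.
  by [].
rewrite eqxx /=; case: (ltngtP j (m 13 i').-1) neq_j => // lt_j _.
  by rewrite row_index_lt.
have le_row : (m 13 i').-1 * p + p <= j * p by rewrite addnC -mulSn leq_mul2r lt_j orbT.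
by rewrite (leq_trans le_row (leq_addr _ _)) orbT.
Qed.

(** Soundness: rows and columns are as many as the respective strategies, so labels that hit every
    strategy are bijective. Completeness: the rows receive the labels of the given labeling, whose
    column labels are a perfect matching for the auction. *)
Lemma recognizeP : let m := result recognize g in
  [/\ m 2 0 <= 1, m 2 0 = 1 -> outputs_labeling g m &
      2 * alpha g <= beta g -> DAV_form g -> m 2 0 = 1].
Proof.
rewrite /result /recognize; set e := fun=> 0; rewrite 5!crun_seq crun_assign -/d.
set m1 := crun d (enumerate 7 1) e _; set m2 := crun d (enumerate 10 2) e m1.
set m3 := crun d label_rows e m2; set m4 := crun d auction e m3.
set m5 := crun d label_columns e m4; set m := update m5 _ _ _.
have p2 : 1 < #|cand g| by apply: ltnW.
have [X bijX m1X] : exists2 X : 'I_k -> strategy (cand g) (alpha g), bijective X &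
    lists m1 8 (fun u => votes (X u)).
  by apply: (@enumP d (cand g) (alpha g) 1 7) => //; apply: nrowsE.
have [Y bijY m2Y] : exists2 Y : 'I_l -> strategy (cand g) (beta g), bijective Y &
    lists m2 11 (fun u => votes (Y u)).
  apply: (@enumP d (cand g) (beta g) 2 10) => //; first exact: ncolsE.
  by move=> i; rewrite /m1 crun_frame.
have frame1 z i : z \notin [:: 7; 8; 9] -> m1 z i = input g z i.
  by move=> z789; rewrite /m1 crun_frame //; move: z789; rewrite /= !inE; lia.
have frame2 z i : z \notin [:: 10; 11; 12] -> m2 z i = m1 z i.
  by move=> z789; rewrite /m2 crun_frame //; move: z789; rewrite /= !inE; lia.
have frame3 z i : z != 3 -> m3 z i = m2 z i.
  by move=> z3; rewrite /m3 crun_frame // inE.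
have frame4 z i : z \notin [:: 13; 14] -> m4 z i = m3 z i.
  by move=> z1314; rewrite /m4 crun_frame.
have frame5 z i : z != 4 -> m5 z i = m4 z i.
  by move=> z4; rewrite /m5 crun_frame // inE.
have frame6 z i : z != 2 -> m z i = m5 z i.
  by move=> z2; rewrite /m update_neq ?z2.
have m2G : has_entries m2.
  by move=> i j; rewrite frame2 // frame1 // input_entry.
have m2X : lists m2 8 (fun u => votes (X u)) by move=> u a; rewrite frame2.
have m3G : has_entries m3 by move=> i j; rewrite frame3.
have m3Y : lists m3 11 (fun u => votes (Y u)) by move=> u a; rewrite frame3.
have own0 i : m3 13 i = 0 by rewrite frame3 // frame2 // frame1.
have price0 i : m3 14 i = 0 by rewrite frame3 // frame2 // frame1.
have [inv4 complete4] := auctionP own0 price0 e.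
rewrite -/m4 in inv4 complete4.
have m4Y : lists m4 11 (fun u => votes (Y u)) by move=> u a; rewrite frame4.
have cols5 := label_columnsP e inv4 m4Y; rewrite -/m5 in cols5.
have answerE : m 2 0 = feval d e m5 answer_form by rewrite /m update_eq.
have answerP : reflect
    ((forall u : 'I_k, exists i : 'I_k, forall a,
        m3 3 (i * p + enum_rank a) = votes (X u) a) /\
     forall y : 'I_l, m4 13 y != 0)
    (feval d e m5 answer_form).
  have row3 i : m5 3 i = m3 3 i by rewrite frame5 // frame4.
  have row8 i : m5 8 i = m2 8 i by rewrite frame5 // frame4 // frame3.
  apply: (iffP andP) => [[/= /forallP rows /forallP cols]|[rows cols]]; split.
  - move=> u; have /existsP[i /forallP eq_i] := rows u; exists i => a.
    by have /eqP := eq_i (enum_rank a); rewrite row3 row8 m2X.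
  - by move=> y; have := cols y; rewrite frame5 // lt0n.
  - apply/forallP => u; have [i eq_i] := rows u; apply/existsP; exists i.
    rewrite /= forall_rank; apply/forallP => a.
    by rewrite row3 row8 m2X eq_i.
  - by apply/forallP => y; rewrite /= frame5 // lt0n.
split; rewrite answerE; first by case: (feval _ _ _ _).
- case: answerP => // -[rows cols] _.
  have row_of u : exists i : 'I_k, [forall a, m3 3 (i * p + enum_rank a) == votes (X u) a].
    by have [i eq_i] := rows u; exists i; apply/forallP => a; rewrite eq_i.
  pose r u := xchoose (row_of u).
  have rE u a : m3 3 (r u * p + enum_rank a) = votes (X u) a.
    by apply/eqP; have /forallP := xchooseP (row_of u); apply.
  have r_inj : injective r.
    move=> u u' eq_r; apply: (bij_inj bijX); apply: strategy_inj => a.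
    by rewrite -!rE eq_r.
  have [r' rK r'K] := injF_bij r_inj.
  have lt_own (y : 'I_l) : (m4 13 y).-1 < l.
    by have := own_le inv4 y; have := cols y; lia.
  pose o y := Ordinal (lt_own y).
  have oE (y : 'I_l) : m4 13 y = (o y).+1 by rewrite /= prednK // lt0n.
  have o_inj : injective o.
    move=> y y' /(congr1 val) /= eq_o; apply: (own_inj inv4) => //.
    by rewrite !oE /= eq_o.
  have [o' oK o'K] := injF_bij o_inj.
  have rows3 : lists m3 3 (fun i => votes (X (r' i))).
    by move=> i a; rewrite -rE r'K.
  exists (X \o r'), (Y \o o'); split.
  + split.
    * by apply: bij_comp => //; exists r.
    * by apply: bij_comp => //; exists o.
    * move=> i j; have ad := own_adm inv4 (oE (o' j)).
      rewrite o'K (admissibleP _ _ m3G rows3 m3Y) in ad.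
      exact: (forallP ad i).
  + move=> i a; rewrite frame6 // frame5 // frame4 //; exact: rows3.
  + move=> j a; rewrite frame6 //; apply: cols5.
    by rewrite oE o'K.
- move=> le_ab [x [y lab]]; have [bijx bijy AMxy] := lab.
  have rows3 : lists m3 3 (fun i => votes (x i)).
    exact: label_rowsP bijX e m2 x y le_ab lab m2G m2X.
  case: answerP => // -[]; split.
    move=> u; have [x' xK x'K] := bijx; exists (x' (X u)) => a.
    by rewrite rows3 x'K.
  apply: complete4; have [Y' YK Y'K] := bijY.
  exists (Y' \o y); first by apply: inj_comp; [exact: (can_inj Y'K)|exact: bij_inj].
  move=> j; rewrite (admissibleP _ _ m3G rows3 m3Y).
  by apply/forallP => i; rewrite /= Y'K.
Qed.

End Recognition.

Theorem theorem8 :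
  [/\ polytime_solvable
        (fun g : voting_form => 3 <= #|cand g| /\ 2 * alpha g <= beta g)
        (answers DAV_form),
      polytime_solvable
        (fun g : voting_form =>
           [/\ 3 <= #|cand g|, 2 * alpha g <= beta g & DAV_form g])
        outputs_labeling &
      forall g : voting_form,
        3 <= #|cand g| -> 2 * alpha g <= beta g -> DAV_form g ->
        forall (x x' : 'I_(nrows g) -> strategy (cand g) (alpha g))
               (y y' : 'I_(ncols g) -> strategy (cand g) (beta g)),
          labeling g x y -> labeling g x' y' -> forall i, x i = x' i].
Proof.
have size_gt0 (g : voting_form) : 3 <= #|cand g| -> 0 < input_size g.
  by rewrite /input_size; lia.
split.
(* One program serves both tasks: the answer is in array 2, the labeling in arrays 3 and 4. *)
- apply: polytime_cmd recognize_wf _ _ => [g [p3 _]|g m [p3 le_ab] eq_m].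
    exact: size_gt0.
  have [le1 out dav] := recognizeP p3.
  rewrite /answers eq_m //.
  have [one|neq1] := eqVneq (result recognize g 2 0) 1.
    by left; split=> //; have [x [y [lab _ _]]] := out one; exists x, y.
  right; split; first by lia.
  by move/(dav le_ab) => one; rewrite one in neq1.
- apply: polytime_cmd recognize_wf _ _ => [g [p3 _ _]|g m [p3 le_ab davg] eq_m].
    exact: size_gt0.
  have [_ out dav] := recognizeP p3.
  have [x [y [lab rows cols]]] := out (dav le_ab davg).
  by exists x, y; split=> // [i a|j a]; rewrite eq_m.
- move=> g p3 le_ab _ x x' y y' lab lab'.
  exact: labeling_rows_unique p3 le_ab lab lab'.
Qed.
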